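(* For each $\delta>0$ there exists an entire function $f\colon\mathbb{C}\to\mathbb{C}$ with a wandering domain $\Omega$ such that $\operatorname{Area}(\mathbb{C}\setminus\Omega)<\delta$.
   Context: $\operatorname{Area}$ denotes two-dimensional Lebesgue measure on $\mathbb{C}$. $f^n$ denotes the $n$-th iterate of $f$. The Fatou set of an entire function $f$ is the set of points $z\in\mathbb{C}$ having an open neighbourhood on which the family $(f^n)_{n\ge1}$ is normal (with values in $\widehat{\mathbb{C}}$). A Fatou component is a connected component of the Fatou set; a Fatou component $\Omega$ is a wandering domain if $f^n(\Omega)\cap f^m(\Omega)=\emptyset$ whenever $n\ne m$. *)

(* Defs.v *)
From HB Require Import structures.
From mathcomp Require Import all_boot all_order all_algebra.
From mathcomp Require Import all_classical all_reals all_analysis.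
From mathcomp Require Import complex.
Set Implicit Arguments.
Unset Strict Implicit.
Unset Printing Implicit Defensive.
Import Order.TTheory GRing.Theory Num.Theory.
Import numFieldNormedType.Exports.
Local Open Scope classical_set_scope.
Local Open Scope complex_scope.
Local Open Scope ring_scope.

(* The complex numbers over R, taken as a numClosedFieldType so that they carry
   the library's norm topology and the structure of a normed module over
   themselves; in particular [derivable f z 1] on [C R] means that the complex
   difference quotient of f at z converges. *)
Definition C (R : realType) : numClosedFieldType := R[i].

Definition entire (R : realType) (f : C R -> C R) : Prop :=
  forall z, derivable f z 1.

(* The product measure is written on R * R, with (x, y) read as x + i y.
   It is only meaningful on Borel sets A, in particular on closed sets. *)
Definition Area (R : realType) (A : set (C R)) : \bar R :=
  (lebesgue_measure \x lebesgue_measure)%E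
    [set p : R * R | A (p.1 +i* p.2 : C R)].

(* The Riemann sphere: [None] is the point at infinity. *)
Definition sphere (R : realType) : Type := one_point_compactification (C R).

Definition modulus (R : realType) (z : C R) : R := complex.Re `|z|.

(* Chordal metric: Euclidean distance in R^3 after stereographic projection
   onto the unit sphere. *)
Definition chordal (R : realType) (p q : sphere R) : R :=
  match p, q with
  | Some z, Some w =>
      2 * modulus (z - w) /
        (Num.sqrt (1 + modulus z ^+ 2) * Num.sqrt (1 + modulus w ^+ 2))
  | Some z, None | None, Some z => 2 / Num.sqrt (1 + modulus z ^+ 2)
  | None, None => 0
  end.

Definition cvg_unif_on_compacts (R : realType) (U : set (C R))
    (u : nat -> C R -> sphere R) (g : C R -> sphere R) : Prop :=
  forall K : set (C R), compact K -> K `<=` U ->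
  forall e : R, 0 < e ->
  \forall n \near \oo, forall z, K z -> chordal (u n z) (g z) < e.

Definition normal_on (R : realType) (U : set (C R))
    (F : set (C R -> sphere R)) : Prop :=
  forall u : nat -> C R -> sphere R, (forall n, F (u n)) ->
  exists (phi : nat -> nat) (g : C R -> sphere R),
    increasing_seq phi /\ cvg_unif_on_compacts U (u \o phi) g.

Definition iterates (R : realType) (f : C R -> C R) :
    set (C R -> sphere R) :=
  [set (fun z => Some (iter n f z)) | n in [set n | (1 <= n)%N]].

Definition Fatou (R : realType) (f : C R -> C R) : set (C R) :=
  [set z | exists U : set (C R), [/\ open U, U z & normal_on U (iterates f)]].

Definition Fatou_component (R : realType) (f : C R -> C R)
    (Omega : set (C R)) : Prop :=
  exists2 z, Fatou f z & Omega = connected_component (Fatou f) z.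

Definition wandering_domain (R : realType) (f : C R -> C R)
    (Omega : set (C R)) : Prop :=
  Fatou_component f Omega /\
  forall n m : nat, n <> m ->
    (iter n f @` Omega) `&` (iter m f @` Omega) = set0.

(* Main.v *)
Require Import Defs.
From HB Require Import structures.
From mathcomp Require Import all_boot all_order all_algebra.
From mathcomp Require Import all_classical all_reals all_analysis.
From mathcomp Require Import complex.
From mathcomp Require Import cyclic separable cyclotomic.
From mathcomp Require Import ring lra zify.
Set Implicit Arguments.
Unset Strict Implicit.
Unset Printing Implicit Defensive.
Import Order.TTheory GRing.Theory Num.Theory.
Import numFieldNormedType.Exports.
Local Open Scope classical_set_scope.
Local Open Scope ring_scope.

(* The map f is a sum of functions, each tiny off a thin tract T around the
   positive real axis, so that f is nearly constant on the connected open set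
   W = C \ T.  Such summands exist because a function which is prescribed on a
   small disc in T and 0 elsewhere is, up to a small error, a polynomial in
   1/(z - b) with b in T, and the pole b can be pushed to infinity through T.
   The summands are chosen inductively so that a point p of the real line
   escapes along T, while f^N_k(W) shrinks to p for some N_k: at stage k a
   small neighbour of p is followed for k steps, ending in a disc which the next
   summand sends back to an even smaller neighbour of p.
   As the f^n have small diameter on W, W lies in one Fatou component Omega.  By
   normality and an identity principle f^N_k tends to p on all of Omega, so
   f^n(a) = f^m(b) with n < m and a, b in Omega would give p = f^(m-n)(p).
   All functions involved are locally uniform limits of real polynomials, for
   which Cauchy's estimates follow from sums over roots of unity. *)

(** * Modulus on the complex plane *)

Section Modulus.
Variable R : realType.
Implicit Types (z w : C R) (x y r : R).

(** The component Omega may be larger than W and is never described; this is why the returns shrink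
    to a single point p, since a common limit can be propagated over a whole component while an
    explicit itinerary of W cannot. The point p cannot be fixed beforehand, because every new
    summand moves all orbits a little. A stage therefore keeps an interval [lo, hi] of candidates
    for p. At stage k some iterate takes W close to f^k(hi). The candidates are cut down to a
    subinterval [m, t0] whose k-th images stay close to f^k(lo), so that no remaining candidate
    comes near f^k(hi) during k steps. There the map is free to be changed so as to send the image
    of W back to t0, the new hi, while another bump near f^k(lo) carries the candidates far to the
    right. Real coefficients keep the real axis invariant, so these choices only need the order of R
    and continuity. The estimates of a stage are made for every map close to the current one on a
    left half-plane, and hence hold for the limit map. *)

Lemma normE z : `|z| = (modulus z)%:C%C.
Proof. by rewrite /modulus [`|z|]normc_def. Qed.

Lemma modulusE z :
  modulus z = Num.sqrt (complex.Re z ^+ 2 + complex.Im z ^+ 2).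
Proof. by rewrite /modulus [`|z|]normc_def. Qed.

Lemma modulus_sqr z : modulus z ^+ 2 = complex.Re z ^+ 2 + complex.Im z ^+ 2.
Proof. by rewrite modulusE sqr_sqrtr // addr_ge0 // sqr_ge0. Qed.

Lemma modulus_ge0 z : 0 <= modulus z.
Proof. by rewrite modulusE sqrtr_ge0. Qed.

Lemma modulus0 : modulus (0 : C R) = 0.
Proof. by rewrite /modulus normr0. Qed.

Lemma modulus1 : modulus (1 : C R) = 1.
Proof. by rewrite /modulus normr1. Qed.

Lemma modulus0_eq z : modulus z = 0 -> z = 0.
Proof. by move=> z0; apply: normr0_eq0; rewrite normE z0. Qed.

Lemma modulus_eq0 z : (modulus z == 0) = (z == 0).
Proof. by apply/eqP/eqP => [/modulus0_eq //|->]; rewrite modulus0. Qed.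

Lemma modulusN z : modulus (- z) = modulus z.
Proof. by rewrite /modulus normrN. Qed.

Lemma modulusB z w : modulus (z - w) = modulus (w - z).
Proof. by rewrite /modulus distrC. Qed.

Lemma modulusM z w : modulus (z * w) = modulus z * modulus w.
Proof.
suff : ((modulus (z * w))%:C = (modulus z * modulus w)%:C :> C R)%C by move=> [].
by rewrite -normE normrM !normE rmorphM.
Qed.

Lemma modulusX z n : modulus (z ^+ n) = modulus z ^+ n.
Proof.
by elim: n => [|n IH]; rewrite ?expr0 ?modulus1 // !exprS modulusM IH.
Qed.

Lemma modulusV z : modulus z^-1 = (modulus z)^-1.
Proof.
have [->|z0] := eqVneq z 0; first by rewrite invr0 modulus0 invr0.
have mz0 : modulus z != 0 by rewrite modulus_eq0.
by apply: (mulfI mz0); rewrite -modulusM !divff // modulus1.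
Qed.

Lemma modulusD z w : modulus (z + w) <= modulus z + modulus w.
Proof. by have := ler_normD z w; rewrite !normE -rmorphD lecR. Qed.

Lemma modulus_tri v z w : modulus (z - w) <= modulus (z - v) + modulus (v - w).
Proof. by rewrite -[X in modulus X](subrKA v) modulusD. Qed.

Lemma modulus_subl z w : modulus z - modulus w <= modulus (z - w).
Proof. by rewrite lerBlDr -{1}(subrK w z) modulusD. Qed.

Lemma modulus_real x : modulus (x%:C%C : C R) = `|x|.
Proof. by rewrite modulusE /= expr0n addr0 sqrtr_sqr. Qed.

Lemma Re_modulus z : `|complex.Re z| <= modulus z.
Proof. by rewrite modulusE -sqrtr_sqr ler_wsqrtr // lerDl sqr_ge0. Qed.

Lemma Im_modulus z : `|complex.Im z| <= modulus z.
Proof. by rewrite modulusE -sqrtr_sqr ler_wsqrtr // lerDr sqr_ge0. Qed.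

Lemma modulus_Re_Im z : modulus z <= `|complex.Re z| + `|complex.Im z|.
Proof.
rewrite -(ler_sqr (modulus_ge0 _)) ?nnegrE ?addr_ge0//.
rewrite modulus_sqr sqrrD !real_normK ?num_real//.
have : 0 <= `|complex.Re z| * `|complex.Im z| by rewrite mulr_ge0.
by rewrite mulr2n; lra.
Qed.

Lemma ReB z w : complex.Re (z - w) = complex.Re z - complex.Re w.
Proof. by case: z w => [a b] [c d]. Qed.

Lemma ImB z w : complex.Im (z - w) = complex.Im z - complex.Im w.
Proof. by case: z w => [a b] [c d]. Qed.

Lemma Re_diff z w : `|complex.Re z - complex.Re w| <= modulus (z - w).
Proof. by rewrite -ReB Re_modulus. Qed.

Lemma modulus_sum (I : Type) (s : seq I) (F : I -> C R) :
  modulus (\sum_(i <- s) F i) <= \sum_(i <- s) modulus (F i).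
Proof.
elim: s => [|a s IH]; first by rewrite !big_nil modulus0.
by rewrite !big_cons (le_trans (modulusD _ _)) ?lerD2l.
Qed.

Lemma C_gt0E (e : C R) : 0 < e -> 0 < complex.Re e /\ e = (complex.Re e)%:C%C.
Proof.
case: e => a b; rewrite ltcE /= => /andP[/eqP b0 a0].
by rewrite b0 a0.
Qed.

(** Ball radii in [C R] are complex numbers; positivity forces them to be real, so topology can be
    expressed through real radii from here on. *)
Lemma nbhs_modulusP (z : C R) (A : set (C R)) :
  nbhs z A <-> exists2 r : R, 0 < r & forall w, modulus (w - z) < r -> A w.
Proof.
split.
  move=> /nbhs_ballP[e /= /C_gt0E[e0 eE] zA]; exists (complex.Re e) => // w wz.
  by apply: zA; rewrite -ball_normE /= normE eE modulusB ltcR.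
move=> [r r0 rA]; apply/nbhs_ballP; exists (r%:C%C : C R); first by rewrite /= ltcR.
by move=> w; rewrite -ball_normE /= normE ltcR modulusB; exact: rA.
Qed.

Lemma open_modulusP (A : set (C R)) :
  open A <-> forall z, A z ->
    exists2 r : R, 0 < r & forall w, modulus (w - z) < r -> A w.
Proof.
rewrite openE; split=> [oA z /oA|oA z /oA] /nbhs_modulusP //.
Qed.

End Modulus.

(** * Uniform approximation by real polynomials *)

Section PolyApprox.
Variable R : realType.
Implicit Types (z : C R) (x y r e : R) (p q : {poly R}) (F : set (C R)).

Definition reval p z : C R := (map_poly (real_complex R) p).[z].

Lemma revalC x z : reval x%:P z = x%:C%C.
Proof. by rewrite /reval map_polyC hornerC. Qed.

Lemma revalX z : reval 'X z = z.
Proof. by rewrite /reval map_polyX hornerX. Qed.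

Lemma revalD p q z : reval (p + q) z = reval p z + reval q z.
Proof. by rewrite /reval rmorphD hornerD. Qed.

Lemma revalN p z : reval (- p) z = - reval p z.
Proof. by rewrite /reval rmorphN hornerN. Qed.

Lemma revalM p q z : reval (p * q) z = reval p z * reval q z.
Proof. by rewrite /reval rmorphM hornerM. Qed.

Lemma reval_exp p n z : reval (p ^+ n) z = reval p z ^+ n.
Proof. by rewrite /reval rmorphXn horner_exp. Qed.

Lemma reval_comp p q z : reval (p \Po q) z = reval p (reval q z).
Proof. by rewrite /reval map_comp_poly horner_comp. Qed.

Lemma reval_real p x : reval p x%:C%C = (p.[x])%:C%C.
Proof. by rewrite /reval horner_map. Qed.

Lemma reval_bounded p r : exists B, 0 < B /\
  forall z, modulus z <= r -> modulus (reval p z) <= B.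
Proof.
elim/poly_ind: p => [|p c [B [B0 pB]]].
  by exists 1; split=> // z _; rewrite /reval rmorph0 horner0 modulus0.
exists (B * Num.max r 0 + (`|c| + 1)); split.
  by rewrite ltr_wpDl ?ltr_wpDl ?mulr_ge0 ?(ltW B0) ?le_max ?lexx ?orbT.
move=> z zr; rewrite revalD revalM revalX revalC.
apply: (le_trans (modulusD _ _)); rewrite modulusM modulus_real.
apply: lerD; last by rewrite lerDl.
by apply: ler_pM; rewrite ?modulus_ge0 ?pB ?le_max ?zr.
Qed.

(** Membership in the uniform closure on [F] of the algebra of real polynomials in [w]. Pole pushing
    takes [w = 1/(z - b)], entire functions take [w = id]. *)
Definition poly_approx (w : C R -> C R) F (phi : C R -> C R) :=
  forall e, 0 < e ->
  exists p, forall z, F z -> modulus (phi z - reval p (w z)) <= e.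

Section BoundedGenerator.
Variables (w : C R -> C R) (F : set (C R)) (B : R).
Hypothesis wB : forall z, F z -> modulus (w z) <= B.
Implicit Types phi psi : C R -> C R.

Lemma poly_approx_reval p : poly_approx w F (fun z => reval p (w z)).
Proof. by move=> e e0; exists p => z _; rewrite subrr modulus0 ltW. Qed.

Lemma poly_approx_eq phi psi : (forall z, F z -> phi z = psi z) ->
  poly_approx w F phi -> poly_approx w F psi.
Proof.
move=> eq_pp pa e /pa[p pP]; exists p => z Fz; rewrite -eq_pp//; exact: pP.
Qed.

Lemma poly_approx_lim phi :
  (forall e, 0 < e -> exists psi, poly_approx w F psi /\
     forall z, F z -> modulus (phi z - psi z) <= e) ->
  poly_approx w F phi.
Proof.
move=> pl e e0; have [|psi [pa pP]] := pl (e / 2); first by rewrite divr_gt0.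
have [|p ppP] := pa (e / 2); first by rewrite divr_gt0.
exists p => z Fz; rewrite (le_trans (modulus_tri (psi z) _ _))//.
by rewrite [leRHS]splitr lerD ?pP ?ppP.
Qed.

Lemma poly_approx_bounded phi : poly_approx w F phi ->
  exists D, 0 < D /\ forall z, F z -> modulus (phi z) <= D.
Proof.
move=> /(_ 1 ltr01)[p pP]; have [D [D0 pD]] := reval_bounded p B.
exists (1 + D); split=> [|z Fz]; first by rewrite addr_gt0.
rewrite -(subrK (reval p (w z)) (phi z)) (le_trans (modulusD _ _))//.
by rewrite lerD ?pP ?pD ?wB.
Qed.

Lemma poly_approxD phi psi : poly_approx w F phi -> poly_approx w F psi ->
  poly_approx w F (fun z => phi z + psi z).
Proof.
move=> ap aq e e0.
have [|p pP] := ap (e / 2); first by rewrite divr_gt0.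
have [|q qP] := aq (e / 2); first by rewrite divr_gt0.
exists (p + q) => z Fz; rewrite revalD opprD addrACA.
by rewrite (le_trans (modulusD _ _))// [leRHS]splitr lerD ?pP ?qP.
Qed.

Lemma poly_approxM phi psi : poly_approx w F phi -> poly_approx w F psi ->
  poly_approx w F (fun z => phi z * psi z).
Proof.
move=> ap aq e e0.
have [D [D0 psiD]] := poly_approx_bounded aq.
have [|p pP] := ap (e / 2 / D); first by rewrite !divr_gt0.
have [E [E0 pE]] := reval_bounded p B.
have [|q qP] := aq (e / 2 / E); first by rewrite !divr_gt0.
exists (p * q) => z Fz; rewrite revalM.
have -> : phi z * psi z - reval p (w z) * reval q (w z) =
  (phi z - reval p (w z)) * psi z + reval p (w z) * (psi z - reval q (w z)).
  by ring.
rewrite (le_trans (modulusD _ _))// [leRHS]splitr !modulusM lerD//.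
- rewrite -[leRHS](divfK (lt0r_neq0 D0)).
  by rewrite ler_pM ?modulus_ge0 ?pP ?psiD.
- rewrite -[leRHS](divfK (lt0r_neq0 E0)) mulrC.
  by rewrite ler_pM ?modulus_ge0 ?qP ?pE ?wB.
Qed.

Lemma poly_approx_cst x : poly_approx w F (fun=> x%:C%C).
Proof.
apply: (poly_approx_eq _ (poly_approx_reval x%:P)) => z _.
exact: revalC.
Qed.

Lemma poly_approx_gen : poly_approx w F w.
Proof.
apply: (poly_approx_eq _ (poly_approx_reval 'X)) => z _.
exact: revalX.
Qed.

Lemma poly_approx_poly p phi : poly_approx w F phi ->
  poly_approx w F (fun z => reval p (phi z)).
Proof.
move=> ap; elim/poly_ind: p => [|p c IH].
  apply: (poly_approx_eq _ (poly_approx_cst 0)) => z _.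
  by rewrite -(revalC _ (phi z)).
apply: (poly_approx_eq _ (poly_approxD (poly_approxM IH ap) (poly_approx_cst c))).
by move=> z _; rewrite revalD revalM revalX revalC.
Qed.

(** Geometric series with ratio at most 1/2. Both the shift of a pole and its final removal reduce
    to this expansion. *)
Lemma poly_approx_geometric k : (forall z, F z -> `|k| * modulus (w z) <= 1 / 2) ->
  poly_approx w F (fun z => (1 - k%:C%C * w z)^-1).
Proof.
move=> kw.
have ap n : poly_approx w F (fun z => \sum_(i < n) (k%:C%C * w z) ^+ i).
  elim: n => [|n IH].
    by apply: (poly_approx_eq _ (poly_approx_cst 0)) => z _; rewrite big_ord0.
  have := poly_approxD (poly_approx_cst 1)
    (poly_approxM (poly_approxM (poly_approx_cst k) poly_approx_gen) IH).
  apply: poly_approx_eq => z _; rewrite big_ord_recl expr0 mulr_sumr.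
  by congr (_ + _); apply: eq_bigr => i _; rewrite exprS.
apply: poly_approx_lim => e e0.
have [n ne] : exists n : nat, 2 * (1 / 2) ^+ n <= e.
  have h : `|1 / 2 : R| < 1 by rewrite ger0_norm; lra.
  have /cvgrPdist_le /(_ (e / 2)) := cvg_expr h.
  case=> [|N _ NP]; first by rewrite divr_gt0.
  exists N; have := NP N (leqnn _); rewrite sub0r normrN ger0_norm ?exprn_ge0//; lra.
exists (fun z => \sum_(i < n) (k%:C%C * w z) ^+ i); split=> // z Fz.
set t := k%:C%C * w z; have tE : modulus t <= 1 / 2.
  by rewrite /t modulusM modulus_real kw.
have t1 : 1 / 2 <= modulus (1 - t).
  by have := modulus_subl 1 t; rewrite modulus1; lra.
have t0 : 1 - t != 0 by rewrite -modulus_eq0; apply/eqP; lra.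
have -> : (1 - t)^-1 - \sum_(i < n) t ^+ i = t ^+ n / (1 - t).
  have tn : (1 - t) * (\sum_(i < n) t ^+ i) = 1 - t ^+ n.
    by rewrite -opprB mulNr -subrX1 opprB.
  by apply: (mulfI t0); rewrite mulrBr tn divff// mulrCA divff// mulr1; ring.
rewrite modulusM modulusX modulusV (le_trans _ ne)// mulrC ler_pM//.
- by rewrite invr_ge0 modulus_ge0.
- by rewrite exprn_ge0 // modulus_ge0.
- rewrite invf_ple ?posrE; lra.
- by rewrite lerXn2r ?nnegrE ?modulus_ge0; lra.
Qed.

End BoundedGenerator.

End PolyApprox.

(** * Cauchy estimates *)

Section CauchyEstimates.
Variable R : realType.
Implicit Types (z w : C R) (x y r e M : R) (p q : {poly R}) (P Q : {poly C R}).

Lemma prim_root_exists n : (0 < n)%N -> exists z : C R, n.-primitive_root z.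
Proof.
move=> n0; pose P : {poly C R} := 'X^n - 1.
have [s Ps] := closed_field_poly_normal P.
rewrite (monicP _) ?monicXnsubC // scale1r in Ps.
have sn : all n.-unity_root s by apply/allP => z; rewrite -root_prod_XsubC -Ps.
have szs : (n < (size s).+1)%N by rewrite -(size_prod_XsubC s id) -Ps size_XnsubC.
have us : uniq s.
  by rewrite -separable_prod_XsubC -Ps separable_Xn_sub_1 // pnatr_eq0 -lt0n.
by have [z _ zP] := hasP (has_prim_root n0 sn us szs); exists z.
Qed.

Lemma modulus_prim_root n z : n.-primitive_root z -> modulus z = 1.
Proof.
move=> zn; apply/eqP; rewrite -(@pexpr_eq1 _ _ n) ?modulus_ge0 ?prim_order_gt0 //.
  by rewrite -modulusX prim_expr_order // modulus1.
exact: prim_order_gt0 zn.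
Qed.

Lemma residue_eq i m n k : (i < n)%N -> (m < n)%N ->
  (i + (n - m) = k * n)%N -> i = m.
Proof. by case: k => [|[|k]]; rewrite ?mul0n ?mul1n ?mulSn; lia. Qed.

(* Averaging P(r w^j) w^(-jm) over the n-th roots of unity w^j, n > deg P,
   isolates the m-th coefficient; this replaces Cauchy's integral formula. *)
Lemma coef_bound P M r : 0 <= r ->
  (forall z, modulus z = r -> modulus P.[z] <= M) ->
  forall m, modulus P`_m * r ^+ m <= M.
Proof.
move=> r0 PM m; have [Pm|mP] := leqP (size P) m.
  rewrite nth_default // modulus0 mul0r (le_trans _ (PM (r%:C)%C _)) ?modulus_ge0 //.
  by rewrite modulus_real ger0_norm.
set n := size P in mP; have n0 : (0 < n)%N by apply: leq_ltn_trans mP.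
have [w wn] := prim_root_exists n0.
have mw := modulus_prim_root wn.
have rw j : modulus ((r%:C)%C * w ^+ j) = r.
  by rewrite modulusM modulus_real modulusX mw expr1n mulr1 ger0_norm.
have key : \sum_(j < n) P.[(r%:C)%C * w ^+ j] * w ^+ (j * (n - m)) =
           n%:R * (P`_m * (r%:C)%C ^+ m).
  transitivity (\sum_(i < n) \sum_(j < n)
      P`_i * (r%:C)%C ^+ i * (w ^+ (i + (n - m))) ^+ j).
    rewrite exchange_big /=; apply: eq_bigr => j _.
    rewrite horner_coef mulr_suml; apply: eq_bigr => i _.
    rewrite exprMn -!exprM mulnDl [in w ^+ (_ + _)]exprD !mulrA.
    by rewrite [(j * i)%N]mulnC [(j * (n - m))%N]mulnC.
  rewrite (bigD1 (Ordinal mP)) //= [X in _ + X]big1 ?addr0.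
    rewrite subnKC ?(ltnW mP)// (prim_expr_order wn).
    rewrite (eq_bigr (fun=> P`_m * (r%:C)%C ^+ m)); last first.
      by move=> j _; rewrite expr1n mulr1.
    by rewrite sumr_const card_ord mulr_natl.
  move=> i /eqP im; rewrite -mulr_sumr.
  have z1 : w ^+ (i + (n - m)) - 1 != 0.
    rewrite subr_eq0 -(prim_order_dvd wn); apply/negP => /dvdnP[k kE].
    by apply: im; apply/val_inj; apply: (residue_eq _ _ kE).
  rewrite (_ : \sum_(j < n) _ = 0) ?mulr0 //.
  apply: (mulfI z1); rewrite -subrX1 mulr0 -exprM mulnC exprM (prim_expr_order wn).
  by rewrite expr1n subrr.
have : n%:R * (modulus P`_m * r ^+ m) <= n%:R * M.
  have -> : n%:R * (modulus P`_m * r ^+ m) = modulus (n%:R * (P`_m * (r%:C)%C ^+ m)).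
    rewrite !modulusM modulusX modulus_real (ger0_norm r0).
    by rewrite -(rmorph_nat (real_complex R)) modulus_real normr_nat.
  rewrite -key (le_trans (modulus_sum _ _))//.
  rewrite (le_trans (ler_sum _ (G := fun=> M) _))//.
    by move=> j _; rewrite modulusM [X in _ * X]modulusX mw expr1n mulr1 PM.
  by rewrite sumr_const card_ord mulr_natl.
by rewrite ler_pM2l // ltr0n.
Qed.

Lemma geometric_half_sum n : \sum_(i < n) (1 / 2 : R) ^+ i <= 2.
Proof.
suff -> : \sum_(i < n) (1 / 2 : R) ^+ i = 2 - 2 * (1 / 2) ^+ n.
  by rewrite gerBl mulr_ge0 // exprn_ge0 //; lra.
elim: n => [|n IH]; first by rewrite big_ord0 expr0; lra.
by rewrite big_ord_recr /= IH exprS; lra.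
Qed.

Lemma half_pow_small M e : 0 < e -> exists n : nat, M * (1 / 2) ^+ n <= e.
Proof.
move=> e0; have h : `|1 / 2 : R| < 1 by rewrite ger0_norm; lra.
have /cvgrPdist_le /(_ (e / (`|M| + 1))) := cvg_expr h.
have M1 : 0 < `|M| + 1 by rewrite ltr_wpDl.
case=> [|N _ NP]; first by rewrite divr_gt0.
exists N; have := NP N (leqnn _).
have h2 : 0 <= (1 / 2 : R) ^+ N by rewrite exprn_ge0 //; lra.
rewrite sub0r normrN ger0_norm // ler_pdivlMr // mulrC => /(le_trans _) -> //.
by rewrite ler_wpM2r //; have := ler_norm M; lra.
Qed.

(** Cauchy's estimate on the unit circle bounds every coefficient by [M]. The constant does not
    depend on the degree, so the estimate survives a passage to the limit. *)
Lemma poly_tail P M n h : 0 <= M ->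
  (forall z, modulus z = 1 -> modulus P.[z] <= M) -> modulus h <= 1 / 2 ->
  modulus (P.[h] - \sum_(i < n) P`_i * h ^+ i) <= 2 * M * modulus h ^+ n.
Proof.
move=> M0 PM hh; have cb i : modulus P`_i <= M.
  by have := coef_bound ler01 PM i; rewrite expr1n mulr1.
rewrite (@horner_coef_wide _ (n + size P)) ?leq_addl// big_split_ord /=.
rewrite addrAC subrr add0r (le_trans (modulus_sum _ _))//.
rewrite (@le_trans _ _ (\sum_(i < size P) M * modulus h ^+ n * (1 / 2) ^+ i))//.
  apply: ler_sum => i _; rewrite modulusM modulusX exprD mulrA.
  have h0 := modulus_ge0 h.
  apply: ler_pM; rewrite ?mulr_ge0 ?exprn_ge0 ?modulus_ge0//.
    by rewrite ler_wpM2r // exprn_ge0.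
  by rewrite lerXn2r ?nnegrE//; lra.
rewrite -mulr_sumr [leRHS](_ : _ = M * modulus h ^+ n * 2); last by ring.
by rewrite ler_wpM2l ?geometric_half_sum // mulr_ge0 // exprn_ge0 // modulus_ge0.
Qed.

(** A weak two-constants theorem. On the disc of radius r/2 the bound [M] makes the terms of degree
    at least [L] small through powers of 1/2; the finitely many lower terms are controlled by [eta],
    with the loss factor [K]. *)
Lemma two_constants_poly M r s e : 0 <= M -> 0 < r -> 0 < s -> 0 < e ->
  exists2 eta, 0 < eta & forall P,
    (forall z, modulus z = r -> modulus P.[z] <= M) ->
    (forall z, modulus z = s -> modulus P.[z] <= eta) ->
    forall z, modulus z <= r / 2 -> modulus P.[z] <= e.
Proof.
move=> M0 r0 s0 e0.
have [L LP] : exists L : nat, (M * 2) * (1 / 2) ^+ L <= e / 2.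
  by apply: half_pow_small; rewrite divr_gt0.
pose K := \sum_(i < L) (r / 2 / s) ^+ i.
have rs0 : 0 <= r / 2 / s by rewrite !divr_ge0 ?ltW.
have K0 : 0 <= K by apply: sumr_ge0 => i _; rewrite exprn_ge0.
have K1 : 0 < K + 1 by rewrite ltr_wpDl.
exists (e / 2 / (K + 1)); first by rewrite !divr_gt0.
set eta := _ / (K + 1); move=> P PM Pe z zr.
have etaK : eta * K <= e / 2.
  rewrite -[leRHS](divfK (lt0r_neq0 K1)) -/eta ler_wpM2l // ?divr_ge0 ?ltW //; lra.
have mz0 := modulus_ge0 z; have r20 : 0 <= r / 2 by rewrite divr_ge0 ?ltW.
have zX i : modulus z ^+ i <= (r / 2) ^+ i by rewrite lerXn2r ?nnegrE.
rewrite (@horner_coef_wide _ (L + size P)) ?leq_addl// big_split_ord /=.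
rewrite (le_trans (modulusD _ _))// [leRHS]splitr lerD//.
  rewrite (le_trans (modulus_sum _ _))// (le_trans _ etaK)// mulr_sumr.
  apply: ler_sum => i _; rewrite modulusM modulusX.
  apply: (le_trans (ler_wpM2l (modulus_ge0 _) (zX i))).
  rewrite [(r / 2 / s) ^+ i]expr_div_n mulrA ler_pdivlMr ?exprn_gt0// mulrAC.
  by rewrite ler_wpM2r ?exprn_ge0// (coef_bound (ltW s0) Pe).
rewrite (le_trans (modulus_sum _ _))// (le_trans _ LP)//.
rewrite (@le_trans _ _ (\sum_(i < size P) M * (1 / 2) ^+ L * (1 / 2) ^+ i))//.
  apply: ler_sum => i _; rewrite modulusM modulusX -mulrA -exprD.
  apply: (le_trans (ler_wpM2l (modulus_ge0 _) (zX (L + i)%N))).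
  have -> : r / 2 = r * (1 / 2) by lra.
  by rewrite exprMn mulrA ler_wpM2r ?(coef_bound (ltW r0) PM)//.
by rewrite -mulr_sumr [leRHS]mulrAC ler_wpM2l ?geometric_half_sum // mulr_ge0.
Qed.

End CauchyEstimates.

(** * Locally uniform limits of real polynomials *)

Section PolynomialLimits.
Variable R : realType.
Implicit Types (z w : C R) (x y r s e M : R) (p q : {poly R}) (f g : C R -> C R).

(** These are the entire functions that are real on the real axis, in a form for which stability
    under composition and uniform limits is direct. *)
Definition pol_lim f := forall r, poly_approx id [set z : C R | modulus z <= r] f.

Lemma disc_id r z : [set z : C R | modulus z <= r] z -> modulus (id z) <= r.
Proof. by []. Qed.

Lemma pol_lim_eq f g : f =1 g -> pol_lim f -> pol_lim g.
Proof. by move=> fg fl r; apply: (poly_approx_eq _ (fl r)) => z _; exact: fg. Qed.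

Lemma pol_lim_reval p : pol_lim (reval p).
Proof. by move=> r; exact: poly_approx_reval. Qed.

Lemma pol_lim_id : pol_lim id.
Proof. by apply: (pol_lim_eq _ (pol_lim_reval 'X)) => z; rewrite revalX. Qed.

Lemma pol_lim_cst x : pol_lim (fun=> x%:C%C).
Proof. by move=> r; exact: poly_approx_cst. Qed.

Lemma pol_limD f g : pol_lim f -> pol_lim g -> pol_lim (fun z => f z + g z).
Proof. by move=> fl gl r; exact: poly_approxD. Qed.

Lemma pol_limM f g : pol_lim f -> pol_lim g -> pol_lim (fun z => f z * g z).
Proof. by move=> fl gl r; exact: (poly_approxM (@disc_id r)). Qed.

Lemma pol_limB f g : pol_lim f -> pol_lim g -> pol_lim (fun z => f z - g z).
Proof.
move=> fl gl; apply: (pol_lim_eq _ (pol_limD fl (pol_limM (pol_lim_cst (-1)) gl))).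
by move=> z; rewrite rmorphN1 mulN1r.
Qed.

Lemma pol_lim_bounded f r : pol_lim f ->
  exists D, 0 < D /\ forall z, modulus z <= r -> modulus (f z) <= D.
Proof. by move=> /(_ r); exact: (poly_approx_bounded (@disc_id r)). Qed.

Lemma pol_lim_comp f g : pol_lim f -> pol_lim g -> pol_lim (f \o g).
Proof.
move=> fl gl r; have [D [D0 gD]] := pol_lim_bounded r gl.
apply: poly_approx_lim => e e0; have [p pP] := fl D e e0.
exists (reval p \o g); split; last by move=> z zr; apply: pP; exact: gD.
exact: (poly_approx_poly (@disc_id r) p (gl r)).
Qed.

Lemma pol_lim_iter f n : pol_lim f -> pol_lim (iter n f).
Proof.
move=> fl; elim: n => [|n IH]; first exact: pol_lim_id.
exact: (pol_lim_comp fl IH).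
Qed.

Lemma pol_lim_uniform f :
  (forall r e, 0 < e -> exists2 g, pol_lim g &
     forall z, modulus z <= r -> modulus (f z - g z) <= e) -> pol_lim f.
Proof.
move=> fl r; apply: poly_approx_lim => e e0.
by have [g gl gP] := fl r e e0; exists g; split => //; exact: gl.
Qed.

Lemma pol_lim_real f x : pol_lim f -> f x%:C%C = (complex.Re (f x%:C%C))%:C%C.
Proof.
move=> fl; suff i0 : complex.Im (f x%:C%C) = 0.
  by case: (f x%:C%C) i0 => a b /= ->.
apply/eqP; rewrite -normr_le0 leNgt; apply/negP => i0.
have [|p pP] := fl `|x| (`|complex.Im (f x%:C%C)| / 2); first by rewrite divr_gt0.
have := pP x%:C%C; rewrite /= modulus_real reval_real => /(_ (lexx _)).
move=> /(le_trans (Im_modulus _)); rewrite ImB /= subr0; lra.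
Qed.

Lemma modulus_complete (u : nat -> C R) :
  (forall e, 0 < e -> exists N, forall m n, (N <= m)%N -> (N <= n)%N ->
     modulus (u m - u n) <= e) ->
  exists l : C R, forall e, 0 < e -> exists N, forall n, (N <= n)%N ->
     modulus (u n - l) <= e.
Proof.
move=> uc.
have lim1 (v : nat -> R) : (forall m n, `|v m - v n| <= modulus (u m - u n)) ->
    exists l : R, forall e, 0 < e -> exists N, forall n, (N <= n)%N -> `|v n - l| <= e.
  move=> vu; have vc : cvg (v @ \oo).
    apply/cauchy_cvgP/cauchy_exP => e e0.
    have [|N NP] := uc (e / 2); first by rewrite divr_gt0.
    exists (v N); exists N => // n /= Nn.
    by rewrite /ball /= (le_lt_trans (vu _ _))// (le_lt_trans (NP _ _ _ _))//; lra.
  exists (lim (v @ \oo)) => e e0; have /cvgrPdist_le /(_ e e0)[N _ NP] := vc.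
  by exists N => n Nn; rewrite distrC; exact: NP.
have [a aP] := lim1 (fun n => complex.Re (u n)) (fun m n => Re_diff _ _).
have [|b bP] := lim1 (fun n => complex.Im (u n)).
  by move=> m n; rewrite -ImB Im_modulus.
exists (a +i* b)%C => e e0.
have [|N NP] := aP (e / 2); first by rewrite divr_gt0.
have [|K KP] := bP (e / 2); first by rewrite divr_gt0.
exists (maxn N K) => n; rewrite geq_max => /andP[Nn Kn].
rewrite (le_trans (modulus_Re_Im _))// [leRHS]splitr lerD//.
- by rewrite ReB; exact: NP.
- by rewrite ImB; exact: KP.
Qed.

Lemma modulus_le_limit z (u : nat -> C R) l M :
  (forall e, 0 < e -> exists N, forall n, (N <= n)%N -> modulus (u n - l) <= e) ->
  (forall e, 0 < e -> exists N, forall n, (N <= n)%N -> modulus (z - u n) <= M + e) ->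
  modulus (z - l) <= M.
Proof.
move=> ul uM; apply/ler_addgt0Pr => e e0.
have [|N NP] := ul (e / 2); first by rewrite divr_gt0.
have [|K KP] := uM (e / 2); first by rewrite divr_gt0.
rewrite (le_trans (modulus_tri (u (maxn N K)) _ _))//.
have := NP _ (leq_maxl N K); have := KP _ (leq_maxr N K); lra.
Qed.

Definition shifted p z : {poly C R} := map_poly (real_complex R) p \Po ('X + z%:P).

Lemma horner_shifted p z w : (shifted p z).[w] = reval p (w + z).
Proof. by rewrite horner_comp hornerD hornerX hornerC. Qed.

(** The derivative is the limit of the linear coefficients of the approximating polynomials
    recentred at [z]: coefficient bounds on the unit circle make these a Cauchy sequence, and
    [poly_tail] gives a remainder that is uniform along the sequence. *)
Lemma pol_lim_taylor f z : pol_lim f -> exists L M, 0 < M /\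
  forall h, modulus h <= 1 / 2 ->
    modulus (f (z + h) - f z - L * h) <= M * modulus h ^+ 2.
Proof.
move=> fl; pose r := modulus z + 1.
have n1 (n : nat) : 0 < (n.+1%:R : R)^-1 by rewrite invr_gt0.
have pc n : exists p, forall w, modulus w <= r -> modulus (f w - reval p w) <= n.+1%:R^-1.
  exact: (fl r (n.+1%:R^-1) (n1 n)).
have [p pP] := choice pc.
have [D [D0 fD]] := pol_lim_bounded r fl.
have dr w : modulus w <= 1 -> modulus (w + z) <= r.
  by move=> w1; rewrite (le_trans (modulusD _ _))// addrC lerD.
pose Q n := shifted (p n) z.
have fQ n w : modulus w <= 1 -> modulus (f (w + z) - (Q n).[w]) <= n.+1%:R^-1.
  by move=> w1; rewrite horner_shifted; apply: pP; exact: dr.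
have QM n w : modulus w = 1 -> modulus (Q n).[w] <= D + 1.
  move=> w1; rewrite -[_.[w]](subrK (f (w + z))) (le_trans (modulusD _ _))//.
  rewrite addrC lerD ?fD ?dr ?w1// modulusB (le_trans (fQ _ _ _)) ?w1//.
  by rewrite invf_le1 // ler1n.
have small e : 0 < e -> exists N, forall n, (N <= n)%N -> (n.+1%:R : R)^-1 <= e.
  move=> e0; have [N _ NP] := near_infty_natSinv_lt (PosNum e0).
  by exists N => n Nn; apply/ltW; exact: NP.
have Qc : forall e, 0 < e -> exists N, forall m n, (N <= m)%N -> (N <= n)%N ->
    modulus ((Q m)`_1 - (Q n)`_1) <= e.
  move=> e e0; have [|N NP] := small (e / 2); first by rewrite divr_gt0.
  exists N => m n Nm Nn; rewrite -coefB.
  rewrite -[leLHS]mulr1 -[X in _ * X](expr1n _ 1); apply: coef_bound => // w w1.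
  rewrite hornerD hornerN.
  rewrite (le_trans (modulus_tri (f (w + z)) _ _))// [leRHS]splitr lerD//.
    by rewrite modulusB (le_trans (fQ _ _ _)) ?w1 ?NP.
  by rewrite (le_trans (fQ _ _ _)) ?w1 ?NP.
have [L LP] := modulus_complete Qc.
exists L, (2 * (D + 1)); split; first by rewrite mulr_gt0 // addr_gt0.
move=> h hh; have h1 : modulus h <= 1 by lra.
apply/ler_addgt0Pr => e e0.
have e3 : 0 < e / 3 by rewrite divr_gt0.
have [N NP] := small _ e3; have [K KP] := LP _ e3.
pose n := maxn N K; have Nn : (N <= n)%N := leq_maxl _ _.
have Kn : (K <= n)%N := leq_maxr _ _.
have D1 : 0 <= D + 1 by rewrite addr_ge0 ?ltW.
have := poly_tail 2 D1 (QM n) hh.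
rewrite big_ord_recl big_ord_recl big_ord0 addr0 /= expr0 expr1 mulr1 => tail.
have q0 : (Q n).[0] = (Q n)`_0 by rewrite horner_coef0.
have -> : f (z + h) - f z - L * h =
    ((Q n).[h] - ((Q n)`_0 + (Q n)`_1 * h)) + ((f (h + z) - (Q n).[h])
    + (((Q n).[0] - f (0 + z)) + ((Q n)`_1 - L) * h)).
  by rewrite q0 add0r (addrC z); ring.
rewrite (le_trans (modulusD _ _))// lerD//.
rewrite (le_trans (modulusD _ _))//.
have a1 := le_trans (fQ n _ h1) (NP n Nn).
have a2 : modulus ((Q n).[0] - f (0 + z)) <= e / 3.
  by rewrite modulusB (le_trans (fQ n _ _)) ?modulus0 ?NP.
have a3 : modulus (((Q n)`_1 - L) * h) <= e / 3.
  rewrite modulusM -[leRHS]mulr1 ler_pM ?modulus_ge0 //; exact: KP.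
have := modulusD ((Q n).[0] - f (0 + z)) (((Q n)`_1 - L) * h); lra.
Qed.

Lemma pol_lim_entire f : pol_lim f -> entire f.
Proof.
move=> fl z; have [L [M [M0 LP]]] := pol_lim_taylor z fl.
apply/cvg_ex; exists L; apply/cvgrPdist_le => e /C_gt0E[e0 ->].
rewrite /dnbhs; apply/nbhs_modulusP; exists (Num.min (1 / 2) (complex.Re e / M)).
  by rewrite lt_min !divr_gt0.
move=> h; rewrite subr0 lt_min => /andP[h1 h2] h0; rewrite normE lecR.
have mh0 : 0 < modulus h by rewrite lt_neqAle modulus_ge0 eq_sym modulus_eq0 h0.
rewrite /= [h%:A]mulr1 [_ *: _]/(_ * _) modulusB.
rewrite -(ler_pM2r mh0) -modulusM mulrBl mulrAC mulVf // mul1r.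
have := LP _ (ltW h1); rewrite [z + h]addrC => /le_trans -> //.
by rewrite expr2 mulrA ler_pM2r // mulrC -ler_pdivlMr // ltW.
Qed.

Lemma pol_lim_continuous f z e : pol_lim f -> 0 < e -> exists2 d, 0 < d &
  forall w, modulus (w - z) <= d -> modulus (f w - f z) <= e.
Proof.
move=> fl e0; have [L [M [M0 LP]]] := pol_lim_taylor z fl.
have K0 : 0 < modulus L + M by rewrite ltr_wpDl // modulus_ge0.
exists (Num.min (1 / 2) (e / (modulus L + M))); first by rewrite lt_min !divr_gt0.
move=> w; rewrite le_min => /andP[w1 w2].
have := LP _ w1; rewrite (addrC z) subrK.
set h := w - z; set d := f w - f z => dP.
rewrite -(subrK (L * h) d) (le_trans (modulusD _ _))//.
rewrite (le_trans (lerD dP (lexx _)))// modulusM.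
move: w2; rewrite ler_pdivlMr // => w2; rewrite (le_trans _ w2)//.
rewrite mulrDr addrC (mulrC (modulus h)) lerD2l mulrC expr2 -mulrA.
have h0 := modulus_ge0 h; rewrite ler_wpM2l // ler_piMl ?ltW//; rewrite -/h in w1; lra.
Qed.

(** [eta] depends neither on [f] nor on the centre, so one choice serves for a whole sequence of
    iterates. *)
Lemma two_constants M r s e : 0 < M -> 0 < r -> 0 < s -> 0 < e ->
  exists2 eta, 0 < eta & forall f z, pol_lim f ->
    (forall w, modulus (w - z) <= r -> modulus (f w) <= M) ->
    (forall w, modulus (w - z) <= s -> modulus (f w) <= eta) ->
    forall w, modulus (w - z) <= r / 2 -> modulus (f w) <= e.
Proof.
move=> M0 r0 s0 e0.
have M1 : 0 <= M + 1 by rewrite addr_ge0 ?ltW.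
have e2 : 0 < e / 2 by rewrite divr_gt0.
have [eta eta0 etaP] := two_constants_poly M1 r0 s0 e2.
exists (eta / 2); first by rewrite divr_gt0.
move=> f z fl fM fe w wr.
(* The approximation error [t] turns the bounds M and eta/2 for [f] into M + 1 and eta for the
   polynomial, and costs at most e/2 on the way back. *)
pose t := Num.min 1 (Num.min (eta / 2) (e / 2)).
have t0 : 0 < t by rewrite !lt_min ltr01 !divr_gt0.
have [p pP] := fl (modulus z + r + s) t t0.
have tP : [/\ t <= 1, t <= eta / 2 & t <= e / 2].
  by split; rewrite !ge_min lexx ?orbT.
have near_disc v : modulus (v - z) <= r + s -> modulus (f v - reval p v) <= t.
  move=> vz; apply: pP; rewrite /= -(subrK z v) (le_trans (modulusD _ _))//.
  by rewrite addrC -addrA lerD2l.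
have pb v : modulus (v - z) <= r + s -> modulus (reval p v) <= modulus (f v) + t.
  move=> /near_disc pv; rewrite -(subrK (f v) (reval p v)).
  by rewrite (le_trans (modulusD _ _))// addrC lerD2l modulusB.
have tr (a : C R) : modulus (a + z - z) = modulus a by rewrite addrK.
have : modulus (shifted p z).[w - z] <= e / 2.
  apply: etaP wr => v vr; rewrite horner_shifted (le_trans (pb _ _)) ?tr ?vr; try lra.
    have := fM (v + z); rewrite tr vr lexx => /(_ isT); case: tP; lra.
  have := fe (v + z); rewrite tr vr lexx => /(_ isT); case: tP; lra.
rewrite horner_shifted subrK => pw.
have wrs : modulus (w - z) <= r + s by lra.
rewrite -(subrK (reval p w) (f w)) (le_trans (modulusD _ _))//.
by have := near_disc _ wrs; case: tP; lra.
Qed.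

End PolynomialLimits.

(** * Pole pushing and bumps along a tract *)

Section PolePushing.
Variable R : realType.
Implicit Types (z w : C R) (x y r e b : R) (p q : {poly R}) (F : set (C R)).

(** The start [n] of the estimates may vary with [z], yet a single limit function serves all points:
    points off the tract are controlled from the start, the others only from some index on. *)
Lemma geometric_limit (u : nat -> C R -> C R) (eps : nat -> R) :
  (forall k, 0 < eps k) -> (forall k, eps k.+1 <= eps k / 2) ->
  exists g : C R -> C R, forall z n,
    (forall k, (n <= k)%N -> modulus (u k.+1 z - u k z) <= eps k / 2) ->
    forall k, (n <= k)%N -> modulus (u k z - g z) <= eps k.
Proof.
move=> eps0 epsS.
pose close z n := forall k, (n <= k)%N -> modulus (u k.+1 z - u k z) <= eps k / 2.
have tail z n k i : close z n -> (n <= k)%N ->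
    modulus (u k z - u (k + i)%N z) <= eps k.
  move=> cl; elim: i k => [|i IH] k nk.
    by rewrite addn0 subrr modulus0 ltW.
  rewrite (le_trans (modulus_tri (u k.+1 z) _ _))// modulusB.
  have := cl k nk; have := IH k.+1 (leqW nk); rewrite addSnnS.
  by have := epsS k; lra.
have small e : 0 < e -> exists N, forall k, (N <= k)%N -> eps k <= e.
  move=> e0; have [N NP] := half_pow_small (eps 0%N) e0.
  have pw k : eps k <= eps 0%N * (1 / 2) ^+ k.
    elim: k => [|k IH]; first by rewrite expr0 mulr1.
    rewrite exprSr mulrA (le_trans (epsS k))//; lra.
  have dec i : eps (N + i)%N <= eps N.
    elim: i => [|i IH]; first by rewrite addn0.
    by rewrite addnS (le_trans (epsS _))//; have := eps0 (N + i)%N; lra.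
  exists N => k Nk; rewrite -(subnKC Nk) (le_trans (dec _))//.
  exact: le_trans (pw N) NP.
have lim z : exists l, forall n, close z n ->
    forall k, (n <= k)%N -> modulus (u k z - l) <= eps k.
  have [[n0 cl0]|ncl] := pselect (exists n, close z n); last first.
    (* Default value at points where the estimates never set in. *)
    by exists 0 => n cl; case: ncl; exists n.
  have [|l lP] := @modulus_complete _ (fun k => u k z).
    move=> e e0; have [|N NP] := small (e / 2); first by rewrite divr_gt0.
    exists (maxn n0 N) => i j; rewrite !geq_max => /andP[n0i Ni] /andP[n0j Nj].
    rewrite (le_trans (modulus_tri (u (maxn n0 N) z) _ _))// [leRHS]splitr.
    have M0 := leq_maxl n0 N; have MN := NP _ (leq_maxr n0 N).
    have iM : (maxn n0 N <= i)%N by rewrite geq_max n0i.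
    have jM : (maxn n0 N <= j)%N by rewrite geq_max n0j.
    rewrite lerD// (le_trans _ MN)//.
      by rewrite modulusB -(subnKC iM); exact: (tail z n0 _ _ cl0 M0).
    by rewrite -(subnKC jM); exact: (tail z n0 _ _ cl0 M0).
  exists l => n cl k nk; apply: (@modulus_le_limit _ _ (fun i => u i z)) => // e e0.
  exists k => i ki; rewrite -(subnKC ki) (le_trans (tail z n k _ cl nk))//; lra.
by have [g gP] := choice lim; exists g.
Qed.

(** With w = 1/(z - b'), one has 1/(z - b) = w / (1 - (b - b') w), and the distance condition bounds
    the ratio by 1/2. The lower bound [k] keeps the generator w bounded. *)
Lemma push_step F b b' k p : 0 < k -> (forall z, F z -> k <= modulus (z - b'%:C%C)) ->
  (forall z, F z -> 2 * `|b - b'| <= modulus (z - b'%:C%C)) ->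
  poly_approx (fun z => (z - b'%:C%C)^-1) F (fun z => reval p (z - b%:C%C)^-1).
Proof.
move=> k0 Fk Fd.
have wB z : F z -> modulus (z - b'%:C%C)^-1 <= k^-1.
  by move=> Fz; rewrite modulusV lef_pV2 ?posrE ?Fk// (lt_le_trans k0 (Fk _ Fz)).
apply: (poly_approx_poly wB).
have geo : poly_approx (fun z => (z - b'%:C%C)^-1) F
    (fun z => (1 - (b - b')%:C%C * (z - b'%:C%C)^-1)^-1).
  apply: (poly_approx_geometric wB) => z Fz.
  have z0 := lt_le_trans k0 (Fk _ Fz).
  by rewrite modulusV ler_pdivrMr //; have := Fd _ Fz; lra.
apply: (poly_approx_eq _ (poly_approxM wB (poly_approx_gen _ _) geo)) => z Fz.
have z0 : z - b'%:C%C != 0.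
  by rewrite -modulus_eq0 lt0r_neq0 // (lt_le_trans k0 (Fk _ Fz)).
rewrite -invfM; congr (_^-1); rewrite mulrBr mulr1 mulrCA mulfV // mulr1.
by rewrite rmorphB; ring.
Qed.

(** A pole outside the disc of radius 2r is removed by expanding at the origin: 1/(z - b) = -(1/b) /
    (1 - z/b). *)
Lemma inv_poly_approx_disc p b r : 0 < b -> 2 * r <= b ->
  poly_approx id [set z : C R | modulus z <= r] (fun z => reval p (z - b%:C%C)^-1).
Proof.
move=> b0 rb; apply: (poly_approx_poly (@disc_id _ r)).
have geo : poly_approx id [set z : C R | modulus z <= r]
    (fun z => (1 - (b^-1)%:C%C * z)^-1).
  apply: (poly_approx_geometric (@disc_id _ r)) => z /= zr.
  by rewrite gtr0_norm ?invr_gt0 // ler_pdivrMl //; lra.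
have bC : b%:C%C != 0 :> C R by rewrite -modulus_eq0 modulus_real normr_eq0 lt0r_neq0.
apply: (poly_approx_eq _ (poly_approxM (@disc_id _ r)
  (@poly_approx_cst _ _ _ (- b^-1)) geo)) => z /= zr.
have zb : z - b%:C%C != 0.
  apply/eqP => /subr0_eq zE; move: zr; rewrite zE modulus_real.
  by rewrite gtr0_norm //; lra.
rewrite rmorphN !fmorphV mulNr -invfM -invrN; congr (_^-1).
by rewrite mulrBr mulr1 mulrA mulfV // mul1r opprB.
Qed.

Lemma push_pole F (theta : R -> R) b p e : 0 < b -> 0 < e ->
  (forall x, 0 < theta x <= 1) -> {homo theta : x y / x <= y >-> y <= x} ->
  (forall x, b <= x -> forall z, F z -> 2 * theta x <= modulus (z - x%:C%C)) ->
  exists2 g, pol_lim g &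
    forall z, F z -> modulus (g z - reval p (z - b%:C%C)^-1) <= e.
Proof.
move=> b0 e0 th0 thd Fth.
(* The step is measured at beta + 1 because theta <= 1 gives beta_(j+1) <= beta_j + 1; by
   monotonicity the step is then at most theta(beta_(j+1)), half of the guaranteed distance from
   beta_(j+1) to F. *)
pose beta j := iter j (fun x => x + theta (x + 1)) b.
have betaS j : beta j.+1 = beta j + theta (beta j + 1) by [].
have th_gt0 x : 0 < theta x by case/andP: (th0 x).
have th_le1 x : theta x <= 1 by case/andP: (th0 x).
have beta_mono i j : (i <= j)%N -> beta i <= beta j.
  move=> ij; rewrite -(subnKC ij); elim: (j - i)%N => [|k IH]; first by rewrite addn0.
  by rewrite addnS betaS (le_trans IH)// lerDl ltW.
have beta_b j : b <= beta j by apply: (beta_mono 0%N).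
(* If the poles stayed below A, every step would be at least theta(A + 1). *)
have unb A : exists J, forall j, (J <= j)%N -> A <= beta j.
  have [//|nA] := pselect (exists J, forall j, (J <= j)%N -> A <= beta j).
  have ltA j : beta j < A.
    rewrite ltNge; apply/negP => Aj; apply: nA; exists j => i ji.
    by rewrite (le_trans Aj)// beta_mono.
  have lin (j : nat) : b + j%:R * theta (A + 1) <= beta j.
    elim: j => [|j IH]; first by rewrite mul0r addr0.
    rewrite betaS -natr1 mulrDl mul1r addrA lerD//; apply: thd.
    by rewrite lerD2r ltW.
  pose n := (Num.truncn ((A - b) / theta (A + 1))).+1.
  have := lin n; have := ltA n.
  have : (A - b) / theta (A + 1) < n%:R by rewrite truncnS_gt.
  rewrite ltr_pdivrMr //; lra.
(* [G j] is where the j-th push is legitimate. It contains F for all j, and every given disc for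
   large j; the latter makes the limit a [pol_lim]. *)
pose G j := [set z : C R | 2 * theta (beta j + 1) <= modulus (z - (beta j.+1)%:C%C)].
have FG j : F `<=` G j.
  move=> z Fz; rewrite /G /= (le_trans _ (Fth _ (beta_b j.+1) _ Fz))//.
  by rewrite ler_pM2l //; apply: thd; rewrite betaS lerD2l.
pose eps (j : nat) : R := e * (1 / 2) ^+ j.
have eps0 j : 0 < eps j by rewrite mulr_gt0 // exprn_gt0 //; lra.
have epsS j : eps j.+1 <= eps j / 2 by rewrite /eps exprSr; lra.
have stepP (jp : nat * {poly R}) : exists q, forall z, G jp.1 z ->
    modulus (reval jp.2 (z - (beta jp.1)%:C%C)^-1 -
             reval q (z - (beta jp.1.+1)%:C%C)^-1) <= eps jp.1 / 2.
  case: jp => j q /=.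
  have k0 : 0 < 2 * theta (beta j + 1) by rewrite mulr_gt0.
  apply: (@push_step (G j) (beta j) (beta j.+1) _ q k0) => //; last by rewrite divr_gt0.
  move=> z; rewrite /G /= => /(le_trans _); apply.
  by rewrite opprD addNKr normrN gtr0_norm.
have [s sP] := choice stepP.
pose P := fix P j := if j is j'.+1 then s (j', P j') else p.
pose u j z := reval (P j) (z - (beta j)%:C%C)^-1.
have uS j z : G j z -> modulus (u j.+1 z - u j z) <= eps j / 2.
  by move=> Gz; rewrite modulusB; exact: (sP (j, P j)).
have [g gP] := geometric_limit u eps0 epsS.
exists g; last first.
  move=> z Fz; rewrite modulusB (le_trans (gP z 0%N _ 0%N _))//.
    by move=> k _; apply/uS/FG.
  by rewrite /eps expr0 mulr1.
move=> r; apply: poly_approx_lim => d d0.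
have [J JP] := unb (2 * `|r| + 2); have [N NP] := half_pow_small e d0.
exists (u (maxn J N)); split.
  apply: inv_poly_approx_disc; first exact: lt_le_trans b0 (beta_b _).
  have := JP _ (leq_maxl J N); have := ler_norm r; lra.
move=> z /= zr; rewrite modulusB (le_trans (gP z J _ _ (leq_maxl _ _)))//.
  move=> k Jk; apply: uS.
  suff : 2 * theta (beta k + 1) <= modulus ((beta k.+1)%:C%C - z) by rewrite modulusB.
  have := modulus_subl (beta k.+1)%:C%C z; rewrite modulus_real.
  have := JP _ (leqW Jk); have := th_le1 (beta k + 1); have := ler_norm r.
  by have := ler_norm (beta k.+1); have := normr_ge0 r; lra.
rewrite (le_trans _ NP)// /eps ler_pM2l //.
by apply: ler_wiXn2l; rewrite ?leq_maxr //; lra.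
Qed.

End PolePushing.

(** * Smoothstep polynomials and bumps inside the tract *)

Section Bump.
Variable R : realType.
Implicit Types (z w t : C R) (x y r e b c : R) (p q : {poly R}) (n : nat).

Definition tract (h : R -> R) : set (C R) :=
  [set z | 0 <= complex.Re z /\ `|complex.Im z| <= h (complex.Re z)].

(* 0 and 1 are superattracting fixed points of 3t^2 - 2t^3. *)
Fixpoint smoothstep n : {poly R} :=
  if n is n'.+1 then smoothstep n' ^+ 2 * (3%:P - 2%:P * smoothstep n') else 'X.

Lemma smoothstepS n t : reval (smoothstep n.+1) t =
  reval (smoothstep n) t ^+ 2 * (3 - 2 * reval (smoothstep n) t).
Proof.
by rewrite /= revalM reval_exp revalD revalN revalM !revalC !rmorph_nat.
Qed.

(** The symmetry exchanges the two fixed points, so one estimate near 0 also covers 1. *)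
Lemma smoothstep_sym n t :
  reval (smoothstep n) (1 - t) = 1 - reval (smoothstep n) t.
Proof.
elim: n => [|n IH]; first by rewrite /= !revalX.
by rewrite !smoothstepS IH; ring.
Qed.

(** Since |3 - 2s| <= 4 for small s, each step at least squares the quantity 4|s|. *)
Lemma smoothstep_small n t : modulus t <= 1 / 8 ->
  4 * modulus (reval (smoothstep n) t) <= (4 * modulus t) ^+ (2 ^ n).
Proof.
move=> t8; have t0 := modulus_ge0 t.
elim: n => [|n IH]; first by rewrite /= revalX expr1.
have le12 : (4 * modulus t) ^+ (2 ^ n) <= 1 / 2.
  have -> : (2 ^ n)%N = ((2 ^ n).-1.+1)%N by rewrite prednK // expn_gt0.
  rewrite exprSr -[leRHS]mul1r ler_pM ?exprn_ge0 ?exprn_ile1 //; lra.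
rewrite smoothstepS expnS mulnC exprM.
set s := reval _ _ in IH *; have s0 := modulus_ge0 s.
have s8 : modulus s <= 1 / 8 by lra.
apply: (@le_trans _ _ ((4 * modulus s) ^+ 2)); last first.
  by rewrite lerXn2r ?nnegrE ?exprn_ge0; lra.
have B : modulus (3 - 2 * s) <= 4.
  rewrite (le_trans (modulusD _ _))// modulusN modulusM.
  rewrite -(rmorph_nat (real_complex R) 3) -(rmorph_nat (real_complex R) 2).
  rewrite !modulus_real !normr_nat; lra.
have := ler_wpM2l (exprn_ge0 2 s0) B.
by rewrite modulusM modulusX exprMn; lra.
Qed.

(** The high order of vanishing at 0 provides the powers of 1/(z - b) that [reverse_poly]
    consumes. *)
Lemma smoothstep_dvd n : exists s, smoothstep n = s * 'X ^+ (2 ^ n).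
Proof.
elim: n => [|n [s sE]]; first by exists 1; rewrite mul1r expr1.
exists (s ^+ 2 * (3%:P - 2%:P * smoothstep n)) => /=.
by rewrite {1}sE exprMn -exprM expnS mulnC mulrAC.
Qed.

(** With w = 1/(z - b), the identity z w = 1 + b w trades each factor z for a polynomial in w, at
    the price of one factor w. *)
Lemma reverse_poly p b : exists N q, forall z, z != b%:C%C ->
  reval q (z - b%:C%C)^-1 = reval p z * (z - b%:C%C)^-1 ^+ N.
Proof.
elim/poly_ind: p => [|p c [N [q qP]]].
  by exists 0%N, 0 => z _; rewrite -polyC0 !revalC mul0r.
exists N.+1, (q * (1 + b%:P * 'X) + c%:P * 'X ^+ N.+1) => z zb.
rewrite -polyC1 !(revalD, revalM, revalX, revalC, reval_exp) qP // rmorph1.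
have zb0 : z - b%:C%C != 0 by rewrite subr_eq0.
have e1 : z * (z - b%:C%C)^-1 = 1 + b%:C%C * (z - b%:C%C)^-1.
  by apply: (mulIf zb0); rewrite mulrDl mul1r -!mulrA mulVf // !mulr1 subrK.
by rewrite -e1 exprSr; ring.
Qed.

Lemma pow2_large i j k : exists n, [/\ i <= 2 ^ n, j <= 2 ^ n - i & k <= 2 ^ n]%N.
Proof.
exists (i + j + k)%N; have := ltnW (@ltn_expl 2 (i + j + k) isT).
by move: (2 ^ (i + j + k))%N => K; split; lia.
Qed.

Section BumpTract.
Variable h : R -> R.
Hypothesis h_gt0 : forall x, 0 < h x.
Hypothesis h_noninc : {homo h : x y / x <= y >-> y <= x}.

(** The function t = -9r/(z - b) with b = c + 9r equals 1 at c. On the disc of radius r around c one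
    has |z - b| >= 8r and |t - 1| <= 1/8; at distance at least 72r from b one has |t| <= 1/8. An
    iterated smoothstep of t is thus nearly 1 on the disc and nearly 0 far away. Multiplied by a
    polynomial close to [u] it is still a polynomial in 1/(z - b), whose pole is then pushed to
    infinity. *)
Lemma tract_bump c r u tau e : 0 < r -> 100 * r <= 1 -> 1 <= c -> 100 * r <= h (c + 1) ->
  pol_lim u -> 0 < tau -> 0 < e ->
  exists g, [/\ pol_lim g,
    forall z, modulus (z - c%:C%C) <= r -> modulus (g z - u z) <= tau &
    forall z, ~ tract h z \/ complex.Re z <= c - 100 * r -> modulus (g z) <= e].
Proof.
move=> r0 r1 c1 rh ul tau0 e0.
pose b := c + 9 * r; have b0 : 0 < b by rewrite /b; lra.
pose F := [set z : C R | ~ tract h z \/ complex.Re z <= b - r].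
(* A point off the tract with real part at most x + 1 lies at distance at least h(x + 1) from x; a
   larger real part already gives distance 1 >= r. *)
pose theta x := Num.min r (h (x + 1)) / 2.
have notin z : ~ tract h z -> complex.Re z < 0 \/ h (complex.Re z) < `|complex.Im z|.
  move=> nT; have [z0|] := ltP (complex.Re z) 0; first by left.
  by move=> z0; right; rewrite ltNge; apply/negP => hz; apply: nT; split.
have Im_le x z : `|complex.Im z| <= modulus (z - x%:C%C).
  by rewrite (le_trans _ (Im_modulus _))// ImB /= subr0.
have Re_le x z : `|complex.Re z - x| <= modulus (z - x%:C%C).
  exact: (Re_diff z x%:C%C).
have theta01 x : 0 < theta x <= 1.
  rewrite /theta divr_gt0 ?lt_min ?r0 ?h_gt0 //= ler_pdivrMr // mul1r.
  by rewrite ge_min; apply/orP; left; lra.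
have theta_noninc : {homo theta : x y / x <= y >-> y <= x}.
  move=> x y xy; rewrite /theta ler_pM2r ?invr_gt0 // le_min ge_min lexx /=.
  by rewrite ge_min h_noninc ?orbT // lerD2r.
have theta_dist x : b <= x -> forall z, F z -> 2 * theta x <= modulus (z - x%:C%C).
  move=> bx z Fz; rewrite /theta mulrC divfK // ge_min.
  have := Re_le x z; have := ler_norm (x - complex.Re z); rewrite distrC => n1 n2.
  have n3 := le_trans (ler_norm (complex.Re z - x)) n2.
  move: Fz => [/notin[zlt0|hz]|zb]; last by apply/orP; left; lra.
    by apply/orP; left; move: bx; rewrite /b; lra.
  have [zx|xz] := leP (complex.Re z) (x + 1); last by apply/orP; left; lra.
  by apply/orP; right; rewrite (le_trans (h_noninc zx))// (le_trans (ltW hz)).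
have far z : ~ tract h z \/ complex.Re z <= c - 100 * r ->
    72 * r <= modulus (z - b%:C%C).
  move=> zF; rewrite leNgt; apply/negP => zb.
  have := Re_le b z; have := ler_norm (b - complex.Re z); rewrite distrC => n1 n2.
  have n3 := le_trans (ler_norm (complex.Re z - b)) n2.
  have i1 := Im_le b z.
  have hz : h (c + 1) <= h (complex.Re z) by apply: h_noninc; move: n3 zb; rewrite /b; lra.
  by move: zF => [/notin[]|]; move: zb; rewrite /b in n1 n2 n3 *; lra.
have [Q QP] := ul (c + r) _ (divr_gt0 tau0 (ltr0n R 3)).
have [N [q qP]] := reverse_poly Q b.
have [B1 [B10 qB]] := reval_bounded q (72 * r)^-1.
have [B2 [B20 QB]] := reval_bounded Q (c + r).
have [m1 m1P] := half_pow_small (B1 * (36 * r) ^+ N) (divr_gt0 e0 (ltr0n R 2)).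
have [m2 m2P] := half_pow_small B2 (divr_gt0 tau0 (ltr0n R 3)).
(* Of the exponent 2^n, N factors compensate the growth of Q and at least m1 are left for smallness
   far from b; m2 serves near c. *)
have [n [nN nm1 nm2]] := pow2_large N m1 m2.
have half_mono i j : (i <= j)%N -> (1 / 2 : R) ^+ j <= (1 / 2) ^+ i.
  by move=> ij; apply: ler_wiXn2l => //; lra.
have [s sE] := smoothstep_dvd n.
pose k := - (9 * r).
(* In terms of w = 1/(z - b), this is Q(z) times smoothstep(k w), with N of the 2^n factors of w
   absorbed in [q]. *)
pose psi : {poly R} := q * ((k ^+ (2 ^ n))%:P * 'X ^+ (2 ^ n - N) * (s \Po (k%:P * 'X))).
have psiP z : z != b%:C%C -> reval psi (z - b%:C%C)^-1 =
    reval Q z * reval (smoothstep n) (k%:C%C * (z - b%:C%C)^-1).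
  move=> zb; rewrite sE /psi !(revalM, reval_exp, reval_comp, revalC, revalX) qP //.
  rewrite exprMn rmorphXn.
  have -> : (z - b%:C%C)^-1 ^+ (2 ^ n) =
      (z - b%:C%C)^-1 ^+ N * (z - b%:C%C)^-1 ^+ (2 ^ n - N).
    by rewrite -exprD subnKC.
  by ring.
have mn0 : 0 < Num.min (tau / 3) (e / 2) by rewrite lt_min !divr_gt0.
have [g gl gP] := push_pole psi b0 mn0 theta01 theta_noninc theta_dist.
have mk : modulus (k%:C%C : C R) = 9 * r.
  by rewrite modulus_real /k normrN gtr0_norm // mulr_gt0.
exists g; split=> //.
- move=> z zc.
  have zb : z != b%:C%C.
    apply/eqP => zE; move: zc; rewrite zE -rmorphB modulus_real /b.
    by have := ler_norm (c + 9 * r - c); lra.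
  have Fz : F z.
    right; have := le_trans (ler_norm _) (le_trans (Re_diff z c%:C%C) zc).
    by rewrite /b /=; lra.
  have zd : modulus z <= c + r.
    rewrite -(subrK c%:C%C z) (le_trans (modulusD _ _))// addrC modulus_real.
    by rewrite gtr0_norm ?lerD//; lra.
  have zb0 : z - b%:C%C != 0 by rewrite subr_eq0.
  have d8 : 8 * r <= modulus (z - b%:C%C).
    have := modulus_tri z b%:C%C c%:C%C; rewrite [modulus (b%:C%C - z)]modulusB.
    rewrite -rmorphB modulus_real /b addrC addKr gtr0_norm; first lra.
    by rewrite mulr_gt0.
  have t8 : modulus (1 - k%:C%C * (z - b%:C%C)^-1) <= 1 / 8.
    have -> : 1 - k%:C%C * (z - b%:C%C)^-1 = (z - c%:C%C) * (z - b%:C%C)^-1.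
      apply: (mulIf zb0); rewrite mulrBl -!mulrA mulVf // !mulr1 mul1r /k /b.
      by rewrite rmorphN rmorphD; ring.
    rewrite modulusM modulusV ler_pdivrMr; first lra.
    by rewrite (lt_le_trans _ d8)// mulr_gt0.
  have := smoothstep_small n t8; rewrite smoothstep_sym.
  set t := k%:C%C * _; set S := reval (smoothstep n) t => Ss.
  have Se : modulus (1 - S) <= (1 / 2) ^+ m2.
    have S1 : modulus (1 - S) <= 4 * modulus (1 - S) by rewrite ler_peMl ?modulus_ge0 // ler1n.
    rewrite (le_trans S1)// (le_trans Ss)// (@le_trans _ _ ((1 / 2) ^+ (2 ^ n)))//.
      by rewrite lerXn2r ?nnegrE ?mulr_ge0 ?modulus_ge0//; move: t8; rewrite -/t; lra.
    exact: half_mono.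
  have e1 : modulus (reval Q z - reval Q z * S) <= tau / 3.
    rewrite -{1}[reval Q z]mulr1 -mulrBr modulusM (le_trans _ m2P)//.
    by rewrite ler_pM ?modulus_ge0 ?QB.
  have e2 : modulus (g z - reval Q z * S) <= tau / 3.
    by rewrite -psiP // (le_trans (gP z Fz))// ge_min lexx.
  have e3 := QP z zd; rewrite /= in e3.
  have := modulus_tri (reval Q z * S) (g z) (u z).
  have := modulus_tri (reval Q z) (reval Q z * S) (u z).
  by rewrite (modulusB _ (reval Q z)) (modulusB (reval Q z) (u z)); lra.
- move=> z zF; have zfar := far z zF.
  have zb : z != b%:C%C.
    by apply/eqP => zE; move: zfar; rewrite zE subrr modulus0; lra.
  have Fz : F z by case: zF => [?|?]; [left|right; rewrite /b; lra].
  have r72 : 0 < 72 * r by rewrite mulr_gt0.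
  set w := (z - b%:C%C)^-1.
  have mw : modulus w <= (72 * r)^-1.
    by rewrite /w modulusV lef_pV2 ?posrE // (lt_le_trans r72).
  have mw0 := modulus_ge0 w.
  have rw : r * modulus w <= 1 / 72.
    have -> : 1 / 72 = r * (72 * r)^-1 :> R by rewrite invfM mulrCA mulfV ?lt0r_neq0//; lra.
    by rewrite ler_pM2l.
  have t8 : modulus (k%:C%C * w) <= 1 / 8 by rewrite modulusM mk; lra.
  have := smoothstep_small n t8; set S := reval _ _ => Ss.
  have rw0 : 0 <= r * modulus w by rewrite mulr_ge0 // ltW.
  have e1 : modulus (reval Q z * S) <= e / 2.
    rewrite modulusM (@le_trans _ _ (modulus (reval Q z) *
      ((36 * r) ^+ N * modulus w ^+ N * (1 / 2) ^+ m1)))//.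
      rewrite ler_wpM2l ?modulus_ge0 //.
      have S1 : modulus S <= 4 * modulus S by rewrite ler_peMl ?modulus_ge0 // ler1n.
      rewrite (le_trans S1)// (le_trans Ss)// modulusM mk.
      have -> : 4 * (9 * r * modulus w) = 36 * r * modulus w by ring.
      rewrite -{1}(subnKC nN).
      rewrite exprD -exprMn ler_wpM2l ?exprn_ge0 //; first by rewrite -mulrA mulr_ge0.
      rewrite (@le_trans _ _ ((1 / 2) ^+ (2 ^ n - N)))//.
        by rewrite lerXn2r ?nnegrE -?mulrA ?mulr_ge0//; lra.
      exact: half_mono.
    rewrite (le_trans _ m1P)// [leLHS](_ : _ =
      (modulus (reval Q z * w ^+ N)) * (36 * r) ^+ N * (1 / 2) ^+ m1); last first.
      by rewrite modulusM modulusX; ring.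
    rewrite -qP // ler_wpM2r ?exprn_ge0 // ler_wpM2r ?qB ?exprn_ge0 //.
    by rewrite mulr_ge0 // ltW.
  have e2 : modulus (g z - reval Q z * S) <= e / 2.
    by rewrite -psiP // (le_trans (gP z Fz))// ge_min lexx orbT.
  rewrite -(subrK (reval Q z * S) (g z)) (le_trans (modulusD _ _))//; lra.
Qed.

End BumpTract.
End Bump.

(** * Inductive construction of the map *)

Section Stages.
Variable R : realType.
Implicit Types (z w : C R) (x y r e a : R) (f g : C R -> C R) (j k n : nat).

(** Left half-planes are what later bumps, placed further and further to the right, leave almost
    untouched. *)
Definition close_on a e f g := forall w, complex.Re w <= a -> modulus (g w - f w) <= e.

Lemma close_on_refl a e f : 0 <= e -> close_on a e f f.
Proof. by move=> e0 w _; rewrite subrr modulus0. Qed.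

Lemma close_on_trans a a1 a2 e1 e2 f g h : a <= a1 -> a <= a2 ->
  close_on a1 e1 f g -> close_on a2 e2 g h -> close_on a (e1 + e2) f h.
Proof.
move=> aa1 aa2 fg gh w wa; rewrite (le_trans (modulus_tri (g w) _ _))// addrC.
by rewrite lerD ?fg ?gh ?(le_trans wa).
Qed.

(** Only the first n points must lie to the left of [a], since the maps are evaluated only there;
    the n-th image may lie anywhere. *)
Lemma iter_stable f n z a eta : pol_lim f -> 0 < eta ->
  (forall j, (j < n)%N -> complex.Re (iter j f z) < a) ->
  exists d e, [/\ 0 < d, 0 < e & forall g, close_on a e f g ->
    forall w, modulus (w - z) <= d -> forall j, (j <= n)%N ->
    modulus (iter j g w - iter j f z) <= eta].
Proof.
move=> fl; elim: n eta => [|n IH] eta eta0 za.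
  exists eta, 1; split=> // g _ w wz j.
  by rewrite leqn0 => /eqP ->.
have eta20 : 0 < eta / 2 by rewrite divr_gt0.
have [d1 d10 fd1] := pol_lim_continuous (iter n f z) fl eta20.
(* The third term keeps the perturbed n-th point in the half-plane where [g] is close to [f]. *)
pose m := Num.min eta (Num.min d1 (a - complex.Re (iter n f z))).
have m0 : 0 < m by rewrite !lt_min eta0 d10 subr_gt0 za.
have mP : [/\ m <= eta, m <= d1 & m <= a - complex.Re (iter n f z)].
  by rewrite /m !ge_min !lexx !orbT.
have [||d [e [d0 e0 deP]]] := IH m => //; first by move=> j jn; apply: za; exact: leqW.
exists d, (Num.min e (eta / 2)); split; rewrite ?lt_min ?e0 // => g gf w wz j.
have gfe : close_on a e f g.
  by move=> v va; rewrite (le_trans (gf v va))// ge_min lexx.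
rewrite leq_eqVlt => /orP[/eqP -> /=|]; last first.
  by move=> jn; rewrite (le_trans (deP g gfe w wz j jn))//; case: mP.
have := deP g gfe w wz n (leqnn n); set p := iter n g w; set q := iter n f z => pq.
have pa : complex.Re p <= a.
  have := le_trans (ler_norm _) (Re_diff p q); case: mP; rewrite -/q; lra.
rewrite (le_trans (modulus_tri (f p) _ _))// [leRHS]splitr lerD//.
  by rewrite (le_trans (gf p pa))// ge_min lexx orbT.
by apply: fd1; rewrite (le_trans pq)//; case: mP.
Qed.

Definition orbit f n x := complex.Re (iter n f x%:C%C).

Lemma orbitE f n x : pol_lim f -> iter n f x%:C%C = (orbit f n x)%:C%C.
Proof. by move=> fl; rewrite /orbit -(pol_lim_real x (pol_lim_iter n fl)). Qed.

(** Applied to the k-th iterate, which need not be monotone: just to the right of [m] its values are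
    slightly above that at the low end, so a short interval starting at [m] has distinct end images,
    both close to the old one. *)
Lemma last_low_point (phi : R -> R) u v : u < v -> phi u < phi v ->
  (forall x e, 0 < e -> exists2 d, 0 < d & forall y, `|y - x| <= d -> `|phi y - phi x| <= e) ->
  exists m, [/\ u <= m, m < v, phi m = phi u &
    forall t, m < t <= v -> phi u < phi t].
Proof.
move=> uv puv pc.
pose A := [set r | u <= r <= v /\ phi r <= phi u].
have Au : A u by split; rewrite ?lexx ?ltW.
have supA : has_sup A by split; [exists u|exists v => r [/andP[]]].
have mA r : A r -> r <= sup A by move=> Ar; apply: ub_le_sup => //; case: supA.
have mv : sup A <= v by apply: ge_sup; [exists u|move=> r [/andP[]]].
have above t : sup A < t <= v -> phi u < phi t.
  move=> /andP[mt tv]; rewrite ltNge; apply/negP => pt.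
  have := mt; rewrite ltNge => /negP; apply; apply: (mA t); split=> //.
  by rewrite tv andbT (le_trans (mA _ Au)) ?ltW.
have pm : phi (sup A) <= phi u.
  rewrite leNgt; apply/negP => pmu.
  have [|d d0 dP] := pc (sup A) ((phi (sup A) - phi u) / 2).
    by rewrite divr_gt0 ?subr_gt0.
  have [r Ar rm] := sup_adherent d0 supA.
  have := mA r Ar; have [_ pr] := Ar; move=> rs.
  have : `|phi r - phi (sup A)| <= (phi (sup A) - phi u) / 2.
    by apply: dP; rewrite ler_norml; lra.
  by rewrite ler_norml; lra.
have mlt : sup A < v.
  rewrite lt_neqAle mv andbT; apply/eqP => mE; move: pm; rewrite mE; lra.
exists (sup A); split=> //; first exact: mA.
apply/eqP; rewrite eq_le pm /= leNgt; apply/negP => pmu.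
have [|d d0 dP] := pc (sup A) ((phi u - phi (sup A)) / 2).
  by rewrite divr_gt0 ?subr_gt0.
pose t := Num.min (sup A + d) v.
have tm : sup A < t by rewrite lt_min mlt ltrDl d0.
have tP : t <= sup A + d /\ t <= v by rewrite !ge_min !lexx orbT.
have := above t; rewrite tm; case: tP => t1 -> /(_ isT).
have : `|phi t - phi (sup A)| <= (phi u - phi (sup A)) / 2.
  by apply: dP; rewrite ler_norml; lra.
by rewrite ler_norml; lra.
Qed.

Lemma below_all (s : seq R) : all (fun x => 0 < x) s ->
  exists2 e, 0 < e & all (fun x => e <= x) s.
Proof.
elim: s => [|b s IH] /=; first by exists 1.
move=> /andP[b0 /IH[e e0 es]]; exists (Num.min b e); first by rewrite lt_min b0.
rewrite ge_min lexx /=; apply: sub_all es => c ec.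
by rewrite ge_min ec orbT.
Qed.

Lemma small_radius b c : 0 < b -> 0 < c ->
  exists r, [/\ 0 < r, r <= b, 100 * r <= 1 & 100 * r <= c].
Proof.
move=> b0 c0; have [|r r0 /= /and4P[rb r1 rc _]] := @below_all [:: b; 1 / 100; c / 100].
  by rewrite /= b0 !divr_gt0.
by exists r; split=> //; lra.
Qed.

Lemma orbit_continuous f n x e : pol_lim f -> 0 < e -> exists2 d, 0 < d &
  forall y, `|y - x| <= d -> `|orbit f n y - orbit f n x| <= e.
Proof.
move=> fl e0; have [d d0 dP] := pol_lim_continuous x%:C%C (pol_lim_iter n fl) e0.
exists d => // t tx; apply: le_trans (Re_diff _ _) (dP _ _).
by rewrite -rmorphB modulus_real.
Qed.

Lemma Re_close z x e : modulus (z - x%:C%C) <= e -> x - e <= complex.Re z <= x + e.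
Proof.
by move=> /(le_trans (Re_diff _ _)); rewrite ler_norml /=; lra.
Qed.

(* A stage consists of the current map, an interval [lo, hi] of candidates for
   p, the radius of the exit disc around f^k(hi), the half-plane Re z <= bnd on
   which later maps stay within tol of the current one, and the radius of the
   disc around hi into which the previous exit disc is mapped. *)
Record stage := Stage {
  smap : C R -> C R; lo : R; hi : R; rad : R; bnd : R; tol : R; hole : R }.

Variable h : R -> R.
Hypothesis h_gt0 : forall x, 0 < h x.
Hypothesis h_noninc : {homo h : x y / x <= y >-> y <= x}.

Definition exit k (s : stage) := orbit (smap s) k (hi s).

(** The first k points of a candidate lie where the map is frozen up to [tol], and the k-th image of
    [lo] beyond, where the map may still be changed. [ok_gap] separates the exit disc, whose bump
    reaches 100 radii to the left, from points near that image; [ok_small] and [ok_room] are what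
    [tract_bump] requires. *)
Record stage_ok k (s : stage) : Prop := StageOk {
  ok_lim : pol_lim (smap s);
  ok_lt : lo s < hi s;
  ok_orbit : forall x j, lo s <= x <= hi s -> (j < k)%N -> orbit (smap s) j x < bnd s;
  ok_bnd : 0 <= bnd s;
  ok_lo : bnd s + 1 <= orbit (smap s) k (lo s);
  ok_rad : 0 < rad s;
  ok_gap : 300 * rad s <= exit k s - orbit (smap s) k (lo s);
  ok_small : 100 * rad s <= 1;
  ok_room : 100 * rad s <= h (exit k s + 1);
  ok_tol : 0 < tol s }.

(** The dynamical clauses quantify over all [g] close to the new map, so that the limit map inherits
    them. [next_map] and [next_tol] together are the hypotheses of [geometric_limit]. *)
Record stage_next k (s s' : stage) : Prop := StageNext {
  next_lo : lo s <= lo s';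
  next_hi : hi s' <= hi s;
  next_len : hi s' - lo s' <= k.+1%:R^-1;
  next_bnd : bnd s + 1 <= bnd s';
  next_tol : tol s' <= tol s / 2;
  next_map : forall z, ~ tract h z \/ complex.Re z <= bnd s ->
    modulus (smap s' z - smap s z) <= tol s / 2;
  next_hole : 0 < hole s' <= k.+1%:R^-1;
  next_exit : forall g, close_on (bnd s') (tol s') (smap s') g ->
    forall z, modulus (z - (exit k s)%:C%C) <= rad s ->
    modulus (g z - (hi s')%:C%C) <= hole s';
  next_diam : forall g, close_on (bnd s') (tol s') (smap s') g ->
    forall z j, modulus (z - (hi s')%:C%C) <= hole s' -> (j <= k.+1)%N ->
    modulus (iter j g z - iter j g (hi s')%:C%C) <= k.+1%:R^-1;
  next_return : forall g, close_on (bnd s') (tol s') (smap s') g ->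
    forall z, modulus (z - (hi s')%:C%C) <= hole s' ->
    modulus (iter k.+1 g z - (exit k.+1 s')%:C%C) <= rad s';
  next_escape : forall g, close_on (bnd s') (tol s') (smap s') g ->
    forall x, lo s' <= x <= hi s' -> k%:R + 5 <= orbit g k.+1 x }.

Lemma translation_point (f1 : C R -> C R) x X e b t z : modulus (z - t%:C%C) <= e ->
  modulus (f1 z - (z + (X - x)%:C%C)) <= b ->
  modulus (f1 z - (t + (X - x))%:C%C) <= b + e.
Proof.
move=> zt fz; rewrite (le_trans (modulus_tri (z + (X - x)%:C%C) _ _))// lerD //.
by rewrite [(t + _)%:C%C]rmorphD opprD addrACA subrr addr0.
Qed.

(* The orbit of the low end is sent on towards X by a map that is nearly a
   translation around its current position, so that the two ends of the new,
   shorter interval stay apart. *)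
Lemma escape_step f k u v a rho eps len X : pol_lim f -> u < v ->
  (forall x j, u <= x <= v -> (j < k)%N -> orbit f j x < a) -> 0 <= a ->
  a + 1 <= orbit f k u -> 0 < rho -> 100 * rho <= 1 ->
  300 * rho <= orbit f k v - orbit f k u -> 0 < eps -> 0 < len ->
  exists f1 m t0 e1, [/\ pol_lim f1, [/\ u <= m, m < t0, t0 <= v & t0 - m <= len],
    forall z, ~ tract h z \/ complex.Re z <= a -> modulus (f1 z - f z) <= eps,
    0 < e1 /\ (forall g, close_on (orbit f k v - 100 * rho) e1 f1 g ->
      forall t, m <= t <= t0 ->
      (forall j, (j <= k)%N -> orbit g j t < orbit f k v - 100 * rho) /\
      X - 1 <= orbit g k.+1 t) &
    [/\ X - 1 <= orbit f1 k.+1 m, orbit f1 k.+1 m < orbit f1 k.+1 t0 &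
        orbit f1 k.+1 t0 <= orbit f1 k.+1 m + 1]].
Proof.
move=> fl uv fa a0; have phi_cont x e := @orbit_continuous f k x e fl.
have [x xE] : exists x, orbit f k u = x by eexists.
have [y yE] : exists y, orbit f k v = y by eexists.
rewrite xE yE => au rho0 small gap eps0 len0.
have xy : x < y by move: rho0 gap; clear; lra.
have [|m [um mv pm above]] := last_low_point uv _ phi_cont; first by rewrite xE yE.
rewrite xE in pm above.
have [r1 [r10 r1rho r1small r1room]] := small_radius rho0 (h_gt0 (x + 1)).
have fam j : (j < k)%N -> complex.Re (iter j f m%:C%C) < a.
  by move=> jk; apply: fa => //; rewrite um ltW.
have r12 : 0 < r1 / 2 by rewrite divr_gt0.
(* With tolerance r1/2, the k-th images of [m, t0] stay inside the disc around x on which the new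
   map will be nearly a translation. *)
have [d1 [e1 [d10 e10 stab1]]] := iter_stable fl r12 fam.
have [|q q0 /= /and4P[q1 q2 q3 _]] := @below_all [:: v - m; d1; len].
  by rewrite /= subr_gt0 mv d10 len0.
have [t0 [mt0 t0v t0d t0k]] : exists t0, [/\ m < t0, t0 <= v, t0 - m <= d1 & t0 - m <= len].
  by exists (m + q); move: q0 q1 q2 q3; clear; split; lra.
have near_m t : m <= t <= t0 -> modulus (t%:C%C - m%:C%C) <= d1.
  move=> /andP[mt tt0]; rewrite -rmorphB modulus_real ger0_norm ?subr_ge0//.
  by rewrite (le_trans _ t0d)// lerD2r.
have tm0 : m <= t0 <= t0 by rewrite lexx ltW.
have mm0 : m <= m <= t0 by rewrite lexx ltW.
have [x0 x0E] : exists x0, orbit f k t0 = x0 by eexists.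
have xx0 : x < x0 by rewrite -x0E; apply: above; rewrite mt0.
have mxE : iter k f m%:C%C = x%:C%C by rewrite (orbitE _ _ fl) pm.
have x0xE : iter k f t0%:C%C = x0%:C%C by rewrite (orbitE _ _ fl) x0E.
have ff : close_on a e1 f f by apply: close_on_refl; rewrite ltW.
have x0x := stab1 f ff _ (near_m t0 tm0) k (leqnn k).
rewrite mxE x0xE in x0x; have {x0x} /andP[_ /= x0x] := Re_close x0x.
(* Each end will land within gam/8 + gam/8 of its target, so at least gam/2 of the gap survives. *)
have [gam gamE] : exists gam, x0 - x = gam by eexists.
have gam0 : 0 < gam by rewrite -gamE subr_gt0.
have gam8 : 0 < gam / 8 by rewrite divr_gt0.
have gam4 : gam / 8 + gam / 8 = gam / 4 by lra.
have [d2 [e2 [d20 e20 stab2]]] := iter_stable fl gam8 fam.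
have fat j : (j < k)%N -> complex.Re (iter j f t0%:C%C) < a.
  by move=> jk; apply: fa => //; rewrite t0v andbT (le_trans um)// ltW.
have [d3 [e3 [d30 e30 stab3]]] := iter_stable fl gam8 fat.
have [|E1 E10 /= /and5P[E1eps E1e1 E1e2 E1e3 _]] := @below_all [:: eps; e1 / 2; e2; e3].
  by rewrite /= eps0 e20 e30 divr_gt0.
have x1 : 1 <= x by move: a0 au; clear; lra.
have tau10 : 0 < Num.min (gam / 8) (1 / 8) by rewrite lt_min gam8 divr_gt0.
(* Adding a bump that imitates this function turns [f] into nearly z + (X - x) near x. *)
have Xid : pol_lim (fun z => (X - x)%:C%C + z - f z).
  by apply: (pol_limB _ fl); apply: pol_limD (@pol_lim_id R); exact: pol_lim_cst.
have [g1 [g1l g1x g1s]] := tract_bump h_gt0 h_noninc r10 r1small x1 r1room Xid tau10 E10.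
have [f1 f1E] : exists f1, f1 = fun z => f z + g1 z by eexists.
have f1l : pol_lim f1 by rewrite f1E; exact: pol_limD.
have f1x z : modulus (z - x%:C%C) <= r1 ->
    modulus (f1 z - (z + (X - x)%:C%C)) <= gam / 8 /\
    modulus (f1 z - (z + (X - x)%:C%C)) <= 1 / 8.
  move=> zx; have := g1x z zx; rewrite le_min => /andP[].
  have -> : g1 z - ((X - x)%:C%C + z - f z) = f1 z - (z + (X - x)%:C%C).
    by rewrite f1E; ring.
  by [].
have a100 : a <= x - 100 * r1 by move: au r1small; clear; lra.
have f1s z : ~ tract h z \/ complex.Re z <= a -> modulus (f1 z - f z) <= E1.
  move=> za; rewrite f1E addrC addKr; apply: g1s.
  by case: za => [|za]; [left|right; exact: le_trans a100].
have f1f e : E1 <= e -> close_on a e f f1.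
  by move=> E1e w wa; rewrite (le_trans _ E1e)//; apply: f1s; right.
have gamr : gam <= r1 / 2 by move: x0x gamE; clear; lra.
have x1P : modulus (iter k.+1 f1 m%:C%C - X%:C%C) <= gam / 4.
  have := stab2 f1 (f1f _ E1e2) m%:C%C _ k (leqnn k); rewrite subrr modulus0 ltW // => /(_ isT).
  rewrite mxE => mx; have [|fmx _] := f1x (iter k f1 m%:C%C).
    by rewrite (le_trans mx)//; move: gamr gam0; clear; lra.
  have := translation_point mx fmx; by rewrite iterS [x + _]addrC subrK gam4.
have y1P : modulus (iter k.+1 f1 t0%:C%C - (X + gam)%:C%C) <= gam / 4.
  have := stab3 f1 (f1f _ E1e3) t0%:C%C _ k (leqnn k); rewrite subrr modulus0 ltW // => /(_ isT).
  rewrite x0xE => mx; have [|fmx _] := f1x (iter k f1 t0%:C%C).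
    rewrite (le_trans (modulus_tri x0%:C%C _ _))//.
    rewrite -rmorphB modulus_real gamE gtr0_norm //.
    by move: mx gamr gam0; clear; lra.
  have := translation_point mx fmx; rewrite iterS.
  have -> : x0 + (X - x) = X + gam by rewrite -gamE; ring.
  by rewrite gam4.
have E14 : 0 < Num.min (e1 / 2) (1 / 8) by rewrite lt_min !divr_gt0.
have ay : a <= y - 100 * rho by move: au rho0 gap; clear; lra.
exists f1, m, t0, (Num.min (e1 / 2) (1 / 8)); split=> //.
- by move=> z /f1s fz; exact: le_trans fz E1eps.
- split=> // g gf t tm.
  have gf1 : close_on a e1 f g.
    move=> w wa; rewrite [e1]splitr.
    apply: (close_on_trans (lexx a) ay (f1f _ E1e1) _ wa) => v' v'y.
    by rewrite (le_trans (gf _ v'y))// ge_min lexx.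
  have wx := stab1 g gf1 _ (near_m t tm) k (leqnn k); rewrite mxE in wx.
  have below : forall j, (j <= k)%N -> orbit g j t < y - 100 * rho.
    move=> j; rewrite leq_eqVlt => /orP[/eqP -> |jk].
      have /andP[_ ] := Re_close wx; rewrite -/(orbit g k t).
      by move: r1rho rho0 gap; clear; lra.
    have := stab1 g gf1 _ (near_m t tm) j (ltnW jk).
    rewrite [iter j f _](orbitE _ _ fl) => /Re_close/andP[_]; rewrite -/(orbit g j t).
    have := fam j jk; rewrite -/(orbit f j m).
    by move: r1small rho0 gap au; clear; lra.
  split=> //; rewrite /orbit iterS.
  have wa : complex.Re (iter k g t%:C%C) <= y - 100 * rho by exact/ltW/(below k).
  move: (iter k g t%:C%C) wx wa => w wx wa.
  have [|_ f1w] := f1x w; first by move: wx r10; clear; lra.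
  have gw : modulus (g w - f1 w) <= 1 / 8.
    by rewrite (le_trans (gf w wa))// ge_min lexx orbT.
  have /andP[lo1 _] := Re_close (translation_point wx f1w).
  have := le_trans (Re_diff _ _) gw; rewrite ler_norml => /andP[lo2 _].
  by move: lo1 lo2 r1small r10; clear; lra.
- have /andP[x1lo x1hi] := Re_close x1P; have /andP[y1lo y1hi] := Re_close y1P.
  rewrite -/(orbit f1 k.+1 m) in x1lo x1hi; rewrite -/(orbit f1 k.+1 t0) in y1lo y1hi.
  by move: x1lo x1hi y1lo y1hi gam0 gamr r1small; clear; split; lra.
Qed.

(** The orbits of m and t0 stay to the left of y - 100 rho for k steps, so a bump on the disc around
    y hardly disturbs them. It sends that disc close to t0, within a radius [tau] small enough for
    the whole tau-disc around t0 to follow the orbit of t0 for k + 1 steps. *)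
Lemma exit_step f1 k m t0 y rho eps len : pol_lim f1 ->
  (forall j, (j <= k)%N -> orbit f1 j m < y - 100 * rho) ->
  (forall j, (j <= k)%N -> orbit f1 j t0 < y - 100 * rho) ->
  orbit f1 k.+1 m < orbit f1 k.+1 t0 <= orbit f1 k.+1 m + 1 ->
  y + 3 <= orbit f1 k.+1 m -> 1 <= y ->
  0 < rho -> 100 * rho <= 1 -> 100 * rho <= h (y + 1) -> 0 < eps -> 0 < len ->
  exists f2 rho' e' tau, [/\ pol_lim f2,
    forall z, ~ tract h z \/ complex.Re z <= y - 100 * rho -> modulus (f2 z - f1 z) <= eps,
    [/\ 0 < rho', 0 < e', 0 < tau & tau <= len],
    [/\ 300 * rho' <= orbit f2 k.+1 t0 - orbit f2 k.+1 m, 100 * rho' <= 1,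
        100 * rho' <= h (orbit f2 k.+1 t0 + 1) & y + 2 <= orbit f2 k.+1 m] &
    forall g, close_on (y + 1) e' f2 g ->
    [/\ forall z, modulus (z - y%:C%C) <= rho -> modulus (g z - t0%:C%C) <= tau,
        forall z j, modulus (z - t0%:C%C) <= tau -> (j <= k.+1)%N ->
          modulus (iter j g z - iter j g t0%:C%C) <= len &
        forall z, modulus (z - t0%:C%C) <= tau ->
          modulus (iter k.+1 g z - (orbit f2 k.+1 t0)%:C%C) <= rho']].
Proof.
move=> fl fm ft; have [x1 x1E] : exists x, orbit f1 k.+1 m = x by eexists.
have [y1 y1E] : exists x, orbit f1 k.+1 t0 = x by eexists.
rewrite x1E y1E => /andP[xy1 yx1] yx y_ge1 rho0 small room eps0 len0.
have [D DE] : exists D, D = y1 - x1 by eexists.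
have D0 : 0 < D by rewrite DE subr_gt0.
have D400 : 0 < D / 400 by rewrite divr_gt0 // ltr0n.
(* 300 r <= 3D/4 is what remains of the gap D after two errors of at most D/8; the argument y1 + 2
   allows for the new exit point lying up to 1 beyond y1. *)
have [r [r0 rD r1 rh]] := small_radius D400 (h_gt0 (y1 + 2)).
have [|eta eta0 /= /and4P[eta_r eta_l eta_D _]] := @below_all [:: r / 2; len / 2; D / 8].
  by rewrite /= !divr_gt0.
have [d4 [e4 [d40 e40 stab4]]] := @iter_stable f1 k.+1 t0%:C%C (y - 100 * rho) eta fl eta0 ft.
have [d5 [e5 [d50 e50 stab5]]] := @iter_stable f1 k.+1 m%:C%C (y - 100 * rho) eta fl eta0 fm.
have [|tau tau0 /= /and3P[tau_d tau_l _]] := @below_all [:: d4; len].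
  by rewrite /= d40 len0.
have [|E E0 /= /and4P[Eeps Ee4 Ee5 _]] := @below_all [:: eps; e4 / 2; e5 / 2].
  by rewrite /= eps0 !divr_gt0.
have tau20 : 0 < tau / 2 by rewrite divr_gt0.
have t0f1 : pol_lim (fun z => t0%:C%C - f1 z) by exact: pol_limB (pol_lim_cst _) fl.
have [g2 [g2l g2y g2s]] := tract_bump h_gt0 h_noninc rho0 small y_ge1 room t0f1 tau20 E0.
have [f2 f2E] : exists f2, f2 = fun z => f1 z + g2 z by eexists.
have f2l : pol_lim f2 by rewrite f2E; exact: pol_limD.
have f2y z : modulus (z - y%:C%C) <= rho -> modulus (f2 z - t0%:C%C) <= tau / 2.
  move=> zy; have := g2y z zy.
  by have -> : g2 z - (t0%:C%C - f1 z) = f2 z - t0%:C%C by rewrite f2E; ring.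
have f2s z : ~ tract h z \/ complex.Re z <= y - 100 * rho -> modulus (f2 z - f1 z) <= E.
  by move=> zy; rewrite f2E addrC addKr; exact: g2s.
have [|e' e'0 /= /and4P[e'tau e'4 e'5 _]] := @below_all [:: tau / 2; e4 / 2; e5 / 2].
  by rewrite /= !divr_gt0.
have yy : y - 100 * rho <= y + 1 by move: rho0; clear; lra.
have close4 g : close_on (y + 1) e' f2 g -> close_on (y - 100 * rho) e4 f1 g.
  move=> gf w wy; rewrite (le_trans (modulus_tri (f2 w) _ _))// [e4]splitr lerD//.
    by rewrite (le_trans _ e'4)// gf // (le_trans wy).
  by rewrite (le_trans _ Ee4)//; apply: f2s; right.
have close5 g : close_on (y + 1) e' f2 g -> close_on (y - 100 * rho) e5 f1 g.
  move=> gf w wy; rewrite (le_trans (modulus_tri (f2 w) _ _))// [e5]splitr lerD//.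
    by rewrite (le_trans _ e'5)// gf // (le_trans wy).
  by rewrite (le_trans _ Ee5)//; apply: f2s; right.
have f2f2 : close_on (y + 1) e' f2 f2 by apply: close_on_refl; rewrite ltW.
have self4 : modulus (t0%:C%C - t0%:C%C : C R) <= d4 by rewrite subrr modulus0 ltW.
have self5 : modulus (m%:C%C - m%:C%C : C R) <= d5 by rewrite subrr modulus0 ltW.
have t2 := stab4 f2 (close4 f2 f2f2) _ self4 _ (leqnn k.+1).
have m2 := stab5 f2 (close5 f2 f2f2) _ self5 _ (leqnn k.+1).
have /andP[y2lo y2hi] : y1 - eta <= orbit f2 k.+1 t0 <= y1 + eta.
  by move: t2; rewrite [iter k.+1 f1 _](orbitE _ _ fl) y1E => /Re_close.
have /andP[x2lo x2hi] : x1 - eta <= orbit f2 k.+1 m <= x1 + eta.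
  by move: m2; rewrite [iter k.+1 f1 _](orbitE _ _ fl) x1E => /Re_close.
exists f2, r, e', tau; split=> //.
- by move=> z /f2s zE; exact: le_trans Eeps.
- split=> //.
  + move: rD eta_D y2lo x2hi DE D0; clear; lra.
  + rewrite (le_trans rh)// h_noninc //.
    by move: y2hi eta_r r1; clear; lra.
  + by move: x2lo eta_D DE yx yx1; clear; lra.
- move=> g gf; split.
  + move=> z zy; rewrite (le_trans (modulus_tri (f2 z) _ _))// [tau]splitr lerD ?f2y//.
    rewrite (le_trans _ e'tau)// gf //; have /andP[_] := Re_close zy.
    by move: small; clear; lra.
  + move=> z j zt jk; have s1 := stab4 g (close4 g gf) z (le_trans zt tau_d) j jk.
    have s2 := stab4 g (close4 g gf) _ self4 j jk.
    rewrite (le_trans (modulus_tri (iter j f1 t0%:C%C) _ _))//.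
    rewrite (modulusB (iter j f1 t0%:C%C)) [len]splitr.
    by rewrite lerD // (le_trans _ eta_l).
  + move=> z zt; have s1 := stab4 g (close4 g gf) z (le_trans zt tau_d) _ (leqnn k.+1).
    rewrite -(orbitE _ _ f2l) (le_trans (modulus_tri (iter k.+1 f1 t0%:C%C) _ _))//.
    rewrite (modulusB (iter k.+1 f1 t0%:C%C)) [r]splitr.
    by rewrite lerD // (le_trans _ eta_r).
Qed.

Lemma stage_step k s : stage_ok k s ->
  exists s', stage_ok k.+1 s' /\ stage_next k s s'.
Proof.
case: s => f u v rho a eps hole0 [/= fl uv fa a0 au rho0 gap small room eps0].
rewrite /exit /= in gap room.
have k0 : 0 < k.+1%:R^-1 :> R by rewrite invr_gt0.
(* The summand 10 leaves room for the new bound y + 1 and the clauses above it; the summand k makes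
   the candidates escape. *)
have [f1 [m [t0 [e1 [f1l [um mt0 t0v t0k] f1s [e10 esc] [x1 x1y1 y1]]]]]] :=
  escape_step (orbit f k v + 10 + k%:R) fl uv fa a0 au rho0 small gap
    (divr_gt0 eps0 (ltr0n R 4)) k0.
have [y yE] : exists y, orbit f k v = y by eexists.
rewrite yE in gap room f1s esc x1 *.
have mm : m <= m <= t0 by rewrite lexx ltW.
have tm : m <= t0 <= t0 by rewrite lexx ltW.
have f1f1 : close_on (y - 100 * rho) e1 f1 f1 by apply: close_on_refl; rewrite ltW.
have [f1m _] := esc f1 f1f1 m mm.
have [f1t _] := esc f1 f1f1 t0 tm.
have y_ge1 : 1 <= y by move: gap rho0 au a0; clear; lra.
have [|E E0 /= /and3P[Eeps Ee1 _]] := @below_all [:: eps / 4; e1 / 2].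
  by rewrite /= !divr_gt0.
have kR : 0 <= k%:R :> R by [].
have yx1 : y + 3 <= orbit f1 k.+1 m by move: x1 kR; clear; lra.
have xy1 : orbit f1 k.+1 m < orbit f1 k.+1 t0 <= orbit f1 k.+1 m + 1 by rewrite x1y1.
have [f2 [rho' [e' [tau [f2l f2s [rho'0 e'0 tau0 tau_k] [gap' small' room' yx2] rob]]]]] :=
  exit_step f1l f1m f1t xy1 yx1 y_ge1 rho0 small room E0 k0.
have [|tl tl0 /= /and4P[tle' tle1 tleps _]] := @below_all [:: e'; e1 / 2; eps / 2].
  by rewrite /= e'0 !divr_gt0.
have robust g : close_on (y + 1) tl f2 g -> close_on (y + 1) e' f2 g.
  by move=> gf w wy; exact: le_trans (gf w wy) tle'.
have yy : y - 100 * rho <= y + 1 by move: rho0; clear; lra.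
have close1 g : close_on (y + 1) tl f2 g -> close_on (y - 100 * rho) e1 f1 g.
  move=> gf w wy; rewrite (le_trans (modulus_tri (f2 w) _ _))// [e1]splitr lerD//.
    by rewrite (le_trans _ tle1)// gf // (le_trans wy).
  by rewrite (le_trans _ Ee1)//; apply: f2s; right.
have f2f2 : close_on (y + 1) tl f2 f2 by apply: close_on_refl; rewrite ltW.
have exitE : exit k (Stage f u v rho a eps hole0) = y by [].
(* The half-plane Re z <= y + 1 contains the old exit disc, so its return to the new [hi] is frozen
   from now on. *)
exists (Stage f2 m t0 rho' (y + 1) tl tau); split.
  split=> //=.
  - move=> t j tmt; rewrite ltnS => jk; have [/(_ j jk)] := esc f2 (close1 f2 f2f2) t tmt.
    by move: yy; clear; lra.
  - by rewrite addr_ge0 // (le_trans ler01).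
  - by rewrite -addrA.
split; rewrite ?exitE //=.
- by move: gap au rho0; clear; lra.
- move=> z za; rewrite (le_trans (modulus_tri (f1 z) _ _))//.
  have zf1 := f1s z za.
  have : modulus (f2 z - f1 z) <= E.
    apply: f2s; case: za => [|za]; [by left|right].
    by move: za au gap rho0; clear; lra.
  by move: zf1 Eeps; clear; lra.
- by rewrite tau0.
- by move=> g /robust /rob [].
- by move=> g /robust /rob [].
- by move=> g /robust /rob [].
- move=> g /close1 gf t tmt; have [_] := esc g gf t tmt.
  by move: y_ge1; clear; lra.
Qed.

End Stages.

(** * The limit map and its itinerary *)

Section LimitMap.
Variable R : realType.
Variable h : R -> R.
Hypothesis h_gt0 : forall x, 0 < h x.
Hypothesis h_noninc : {homo h : x y / x <= y >-> y <= x}.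

Lemma stage_sequence : exists s : nat -> stage R,
  [/\ forall k, stage_ok h k (s k), forall k, stage_next h k (s k) (s k.+1),
      smap (s 0%N) = (fun=> 3%:C%C) & [/\ lo (s 0%N) = 2, hi (s 0%N) = 3 &
      tol (s 0%N) = rad (s 0%N)]].
Proof.
have step (ks : nat * stage R) : exists s', stage_ok h ks.1 ks.2 ->
    stage_ok h ks.1.+1 s' /\ stage_next h ks.1 ks.2 s'.
  have [ok|nok] := pselect (stage_ok h ks.1 ks.2); last by exists ks.2 => /nok.
  by have [s' sP] := stage_step h_gt0 h_noninc ok; exists s'.
have [next nextP] := choice step.
have b0 : 0 < 1 / 300 :> R by rewrite divr_gt0 // ltr0n.
have [r [r0 r300 r1 rh]] := small_radius b0 (h_gt0 (3 + 1)).
(* The 0-th iterate is the identity, so the exit point is 3 and the gap is 1, whence the bound 1/300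
   for the radius. The constant map 3 with [tol] equal to [rad] lets the limit map send everything
   off the tract into the first exit disc. *)
pose s0 := @Stage R (fun=> 3%:C%C) 2 3 r 1 r 0.
pose s := fix s k := if k is k'.+1 then next (k', s k') else s0.
have ok0 : stage_ok h 0 s0.
  by split=> //=; try lra; exact: pol_lim_cst.
have ok k : stage_ok h k (s k) by elim: k => // k IH; case: (nextP (k, s k) IH).
by exists s; split=> // k; case: (nextP (k, s k) (ok k)).
Qed.

(** The limit map is close to every stage map on the corresponding half-plane, so the robust clauses
    of each [stage_next] apply to it; p is common to all the nested intervals. *)
Lemma wandering_map : exists (f : C R -> C R) (v r y : nat -> R) (p : R),
  [/\ pol_lim f,
      forall z, ~ tract h z -> modulus (f z - (y 0%N)%:C%C) <= r 0%N,
      [/\ forall k, `|v k - p| <= 2 / k.+1%:R, p <= 3 &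
          forall k, k%:R + 5 <= orbit f k.+1 p] &
      exists t : nat -> R, [/\ forall k, 0 < t k <= k.+1%:R^-1,
        forall k z, modulus (z - (y k)%:C%C) <= r k ->
          modulus (f z - (v k)%:C%C) <= t k,
        forall k z j, modulus (z - (v k)%:C%C) <= t k -> (j <= k.+1)%N ->
          modulus (iter j f z - iter j f (v k)%:C%C) <= k.+1%:R^-1 &
        forall k z, modulus (z - (v k)%:C%C) <= t k ->
          modulus (iter k.+1 f z - (y k.+1)%:C%C) <= r k.+1]].
Proof.
have [s [ok nxt s0 [lo0 hi0 tol0]]] := stage_sequence.
have tol_gt0 k : 0 < tol (s k) by exact: ok_tol (ok k).
have tolS k : tol (s k.+1) <= tol (s k) / 2 by exact: next_tol (nxt k).
have [f fP] := geometric_limit (fun k => smap (s k)) tol_gt0 tolS.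
have bndS k n : (n <= k)%N -> bnd (s n) <= bnd (s k).
  move=> nk; rewrite -(subnKC nk); elim: (k - n)%N => [|i IH]; first by rewrite addn0.
  rewrite addnS (le_trans IH)// (le_trans _ (next_bnd (nxt (n + i)%N)))//.
  by rewrite lerDl.
have cl k : close_on (bnd (s k)) (tol (s k)) (smap (s k)) f.
  move=> w wb; rewrite modulusB; apply: (fP w k) => // i ki.
  by apply: (next_map (nxt i)); right; rewrite (le_trans wb)// bndS.
have off z : ~ tract h z -> modulus (f z - smap (s 0%N) z) <= tol (s 0%N).
  move=> zT; rewrite modulusB; apply: (fP z 0%N) => // i _.
  by apply: (next_map (nxt i)); left.
have bnd_ge (n : nat) : n%:R <= bnd (s n).
  elim: n => [|n IH]; first exact: ok_bnd (ok 0%N).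
  by rewrite (le_trans _ (next_bnd (nxt n)))// -natr1 lerD2r.
have tol_pow k : tol (s k) <= tol (s 0%N) * (1 / 2) ^+ k.
  elim: k => [|k IH]; first by rewrite expr0 mulr1.
  by rewrite exprSr mulrA mulrA mulr1 (le_trans (tolS k))// ler_pM2r.
have fl : pol_lim f.
  apply: pol_lim_uniform => r e e0; have [n1 n1P] := half_pow_small (tol (s 0%N)) e0.
  pose n2 := (Num.truncn r).+1.
  have r2 : r <= n2%:R by rewrite ltW // truncnS_gt.
  exists (smap (s (maxn n1 n2))); first exact: ok_lim (ok _).
  move=> z zr; have zb : complex.Re z <= bnd (s (maxn n1 n2)).
    rewrite (le_trans (ler_norm _))// (le_trans (Re_modulus z))// (le_trans zr)//.
    by rewrite (le_trans r2)// (le_trans _ (bnd_ge _))// ler_nat leq_maxr.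
  rewrite (le_trans (cl _ z zb))// (le_trans (tol_pow _))// (le_trans _ n1P)//.
  rewrite ler_pM2l //; apply: ler_wiXn2l; rewrite ?leq_maxl //; lra.
have loS i j : (i <= j)%N -> lo (s i) <= lo (s j).
  move=> ij; rewrite -(subnKC ij); elim: (j - i)%N => [|n IH]; first by rewrite addn0.
  by rewrite addnS (le_trans IH)// (next_lo (nxt _)).
have hiS i j : (i <= j)%N -> hi (s j) <= hi (s i).
  move=> ij; rewrite -(subnKC ij); elim: (j - i)%N => [|n IH]; first by rewrite addn0.
  by rewrite addnS (le_trans _ IH)// (next_hi (nxt _)).
have lohi i j : lo (s i) <= hi (s j).
  rewrite (le_trans (loS _ _ (leq_maxl i j)))// (le_trans _ (hiS _ _ (leq_maxr i j)))//.
  by rewrite ltW // (ok_lt (ok _)).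
pose A := range (fun k => lo (s k)).
have supA : has_sup A.
  by split; [exists (lo (s 0%N)), 0%N|exists (hi (s 0%N)) => _ [k _ <-]].
pose p := sup A.
have lop k : lo (s k) <= p by apply: ub_le_sup; [case: supA|exists k].
have phi k : p <= hi (s k).
  by apply: ge_sup; [case: supA|move=> _ [i _ <-]].
(* The shift in the index of [hi] reflects that the exit disc of stage k is sent to the [hi] of
   stage k + 1. *)
exists f, (fun k => hi (s k.+1)), (fun k => rad (s k)), (fun k => exit k (s k)), p.
split=> //.
- move=> z zT; rewrite -tol0; have := off z zT.
  by rewrite s0 /exit /orbit /= hi0.
- split; first 1 last.
  + by rewrite -hi0.
  + by move=> k; apply: (next_escape (nxt k) (cl k.+1)); rewrite lop phi.
  + move=> k; have := next_len (nxt k); have := lop k.+1; have := phi k.+1.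
    set w := k.+1%:R^-1 => a b c; rewrite ger0_norm ?subr_ge0 //.
    by have w0 : 0 < w; [rewrite invr_gt0|lra].
- exists (fun k => hole (s k.+1)); split.
  + by move=> k; exact: next_hole (nxt k).
  + by move=> k; exact: (next_exit (nxt k) (cl k.+1)).
  + by move=> k z j; exact: (next_diam (nxt k) (cl k.+1)).
  + by move=> k; exact: (next_return (nxt k) (cl k.+1)).
Qed.

End LimitMap.

(** * Normality and Fatou components *)

Section SphereAndSubsequences.
Variable R : realType.
Implicit Types (z w : C R) (x y r e : R) (p q : sphere R).

Definition pair_to_C (u : R * R) : C R := (u.1 +i* u.2)%C.

Lemma pair_to_C_continuous : continuous pair_to_C.
Proof.
move=> u A /nbhs_modulusP[r r0 rA].
have r20 : 0 < r / 2 by rewrite divr_gt0.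
apply/nbhs_ballP; exists (r / 2) => //= v [/= v1 v2]; apply: rA.
rewrite (le_lt_trans (modulus_Re_Im _))// ReB ImB /= [ltRHS]splitr.
by rewrite ltrD // distrC.
Qed.

(** Squares instead of discs: their compactness comes directly from that of a product of
    segments. *)
Definition box (z0 : C R) (r : R) : set (C R) :=
  [set z | `|complex.Re z - complex.Re z0| <= r /\ `|complex.Im z - complex.Im z0| <= r].

Lemma disc_sub_box z0 r z : modulus (z - z0) <= r -> box z0 r z.
Proof.
move=> zr; split; first exact: le_trans (Re_diff _ _) zr.
by rewrite -ImB (le_trans (Im_modulus _)).
Qed.

Lemma box_sub_disc z0 r z : box z0 r z -> modulus (z - z0) <= r + r.
Proof. by move=> [z1 z2]; rewrite (le_trans (modulus_Re_Im _))// ReB ImB lerD. Qed.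

Lemma compact_box z0 r : compact (box z0 r).
Proof.
pose I t := `[t - r, t + r]%classic.
have -> : box z0 r = pair_to_C @` (I (complex.Re z0) `*` I (complex.Im z0)).
  apply/seteqP; split=> [[a b] /= [a1 b1]|_ [[a b] /= [a1 b1] <-]].
    exists (a, b) => //=; split; rewrite /I /= in_itv /=.
      by move: a1; rewrite ler_distl.
    by move: b1; rewrite ler_distl.
  by split; rewrite /= ler_distl; [move: a1|move: b1]; rewrite /I /= in_itv.
apply: continuous_compact.
  by apply: continuous_subspaceT; exact: pair_to_C_continuous.
by apply: compact_setX; exact: segment_compact.
Qed.

Lemma bounded_cluster (u : nat -> C R) (r : R) (P : nat -> Prop) :
  (forall N, exists i, [/\ (N <= i)%N, P i & modulus (u i) <= r]) ->
  exists l, forall e, 0 < e -> forall N, exists i,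
    [/\ (N <= i)%N, P i & modulus (u i - l) <= e].
Proof.
move=> ur; pose A N := [set i | [/\ (N <= i)%N, P i & modulus (u i) <= r]].
pose F : set_system (C R) := filter_from setT (fun N => u @` (A N)).
have FF : ProperFilter F.
  apply: filter_from_proper; last first.
    by move=> N _; have [i Ai] := ur N; exists (u i), i.
  apply: filter_from_filter; first by exists 0%N.
  move=> i j _ _; exists (maxn i j) => // _ [k [+ Pk kr] <-].
  by rewrite geq_max => /andP[ik jk]; split; exists k.
have [|l [_ lc]] := @compact_box 0 r F FF.
  by exists 0%N => // _ [i [_ _ ir] <-]; apply: disc_sub_box; rewrite subr0.
exists l => e e0 N; have FN : F (u @` (A N)) by exists N.
have nl : nbhs l [set w | modulus (w - l) < e] by apply/nbhs_modulusP; exists e.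
have [_ [[i [Ni Pi _] <-] /ltW il]] := lc _ _ FN nl.
by exists i.
Qed.

Lemma extract_subsequence (P : nat -> nat -> Prop) :
  (forall k N, exists i, (N <= i)%N /\ P k i) ->
  exists phi, increasing_seq phi /\ forall k, P k (phi k).
Proof.
move=> H; have [s sP] := choice (fun kN : nat * nat => H kN.1 kN.2).
pose phi := fix phi k := if k is k'.+1 then s (k, (phi k').+1) else s (0%N, 0%N).
exists phi; split; last by case=> [|k]; [have [] := sP (0%N, 0%N)|have [] := sP (k.+1, (phi k).+1)].
by apply/increasing_seqP => k; rewrite ltEnat /=; have [] := sP (k.+1, (phi k).+1).
Qed.

Lemma increasing_seq_ge (phi : nat -> nat) k : increasing_seq phi -> (k <= phi k)%N.
Proof.
move=> /increasing_seqP incr; elim: k => // k IH.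
by rewrite (leq_ltn_trans IH)//; have := incr k; rewrite ltEnat.
Qed.

(** Pigeonhole. A sequence in [iterates f] may use the same iterate infinitely often, and then has a
    constant subsequence. *)
Lemma bounded_recurrent_value (m : nat -> nat) B :
  (forall N, exists i, (N <= i)%N /\ (m i <= B)%N) ->
  exists b, forall N, exists i, (N <= i)%N /\ m i = b.
Proof.
elim: B => [|B IH] mB.
  exists 0%N => N; have [i [Ni]] := mB N; rewrite leqn0 => /eqP m0; by exists i.
have [H|/existsNP[N0 N0P]] := pselect (forall N, exists i, (N <= i)%N /\ m i = B.+1).
  by exists B.+1.
apply: IH => N; have [i []] := mB (maxn N N0); rewrite geq_max => /andP[Ni N0i].
rewrite leq_eqVlt => /orP[/eqP mi|]; last by exists i.
by case: N0P; exists i.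
Qed.

(** Inverse stereographic projection onto the unit sphere. It makes [chordal] comparable with an l1
    distance in R^3, for which the triangle inequality is immediate. *)
Definition stereo p : R * R * R :=
  if p is Some z then
    let: d := 1 + modulus z ^+ 2 in
    (2 * complex.Re z / d, 2 * complex.Im z / d, (modulus z ^+ 2 - 1) / d)
  else (0, 0, 1).

Lemma chordal_ge0 p q : 0 <= chordal p q.
Proof.
have s0 z : 0 <= Num.sqrt (1 + modulus z ^+ 2) by rewrite sqrtr_ge0.
by case: p q => [z|] [w|] //=; rewrite divr_ge0 ?mulr_ge0 ?modulus_ge0.
Qed.

Lemma chordal_sqr p q : chordal p q ^+ 2 =
  ((stereo p).1.1 - (stereo q).1.1) ^+ 2 + ((stereo p).1.2 - (stereo q).1.2) ^+ 2
  + ((stereo p).2 - (stereo q).2) ^+ 2.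
Proof.
have d0 z : 0 < 1 + modulus z ^+ 2 by rewrite ltr_wpDr ?exprn_ge0 ?modulus_ge0.
have dE z : 1 + modulus z ^+ 2 = 1 + (complex.Re z ^+ 2 + complex.Im z ^+ 2).
  by rewrite modulus_sqr.
case: p q => [z|] [w|] /=; rewrite ?expr_div_n ?exprMn ?(sqr_sqrtr (ltW (d0 _))).
- have := lt0r_neq0 (d0 z); have := lt0r_neq0 (d0 w); rewrite !dE => ? ?.
  by rewrite !modulus_sqr ReB ImB; field; apply/andP.
- have := lt0r_neq0 (d0 z); rewrite !dE => ?.
  by rewrite !modulus_sqr; field.
- have := lt0r_neq0 (d0 w); rewrite !dE => ?.
  by rewrite !modulus_sqr; field.
- by ring.
Qed.

Definition stereo_dist p q : R := `|(stereo p).1.1 - (stereo q).1.1|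
  + `|(stereo p).1.2 - (stereo q).1.2| + `|(stereo p).2 - (stereo q).2|.

Lemma chordal_le_stereo p q : chordal p q <= stereo_dist p q.
Proof.
have s0 : 0 <= stereo_dist p q by rewrite !addr_ge0.
rewrite -ler_sqr ?nnegrE ?chordal_ge0 // chordal_sqr /stereo_dist.
set a := _.1.1 - _; set b := _.1.2 - _; set c := _.2 - _.
have sq (t : R) : t ^+ 2 = `|t| ^+ 2 by rewrite real_normK // num_real.
rewrite (sq a) (sq b) (sq c).
have := mulr_ge0 (normr_ge0 a) (normr_ge0 b).
have := mulr_ge0 (normr_ge0 a) (normr_ge0 c).
by have := mulr_ge0 (normr_ge0 b) (normr_ge0 c); lra.
Qed.

Lemma stereo_le_chordal p q : stereo_dist p q <= 3 * chordal p q.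
Proof.
have c0 := chordal_ge0 p q; have := chordal_sqr p q.
rewrite /stereo_dist; set a := _.1.1 - _; set b := _.1.2 - _; set c := _.2 - _ => cE.
have sq (t : R) : t ^+ 2 <= chordal p q ^+ 2 -> `|t| <= chordal p q.
  by move=> tc; rewrite -ler_sqr ?nnegrE // real_normK ?num_real.
have a2 := sqr_ge0 a; have b2 := sqr_ge0 b; have c2 := sqr_ge0 c.
have := sq a; have := sq b; have := sq c; rewrite cE => h1 h2 h3.
by have := h1 _; have := h2 _; have := h3 _; lra.
Qed.

Lemma stereo_dist_tri q p o : stereo_dist p o <= stereo_dist p q + stereo_dist q o.
Proof.
rewrite /stereo_dist.
have := ler_distD (stereo q).1.1 (stereo p).1.1 (stereo o).1.1.
have := ler_distD (stereo q).1.2 (stereo p).1.2 (stereo o).1.2.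
have := ler_distD (stereo q).2 (stereo p).2 (stereo o).2; lra.
Qed.

Lemma stereo_dist_sym p q : stereo_dist p q = stereo_dist q p.
Proof. by rewrite /stereo_dist distrC [X in _ + X + _]distrC [X in _ + _ + X]distrC. Qed.

Lemma chordal_le z w : chordal (Some z) (Some w) <= 2 * modulus (z - w).
Proof.
have s1 (v : C R) : 1 <= Num.sqrt (1 + modulus v ^+ 2) :> R.
  by rewrite -{1}[1](sqrtr1) ler_wsqrtr // lerDl exprn_ge0 // modulus_ge0.
have s0 (v : C R) : 0 < Num.sqrt (1 + modulus v ^+ 2) :> R.
  by apply: (lt_le_trans ltr01); exact: s1.
rewrite /= ler_pdivrMr ?mulr_gt0 //.
by rewrite ler_peMr ?mulr_ge0 ?modulus_ge0 // mulr_ege1.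
Qed.

Lemma chordal_infty z a : 0 < a -> a <= modulus z -> chordal (Some z) None <= 2 / a.
Proof.
move=> a0 az; rewrite /= ler_pM2l // lef_pV2 ?posrE //.
  rewrite (le_trans az)// -[leLHS]ger0_norm ?modulus_ge0 // -sqrtr_sqr.
  by rewrite ler_wsqrtr // lerDr.
by rewrite sqrtr_gt0 ltr_wpDr ?exprn_ge0 ?modulus_ge0.
Qed.

(** The bound is uniform up to infinity because 1 + |z| grows at most linearly in |z - w|. *)
Lemma chordal_separated w : exists2 c, 0 < c & forall z, 1 < modulus (z - w) ->
  c <= chordal (Some z) (Some w).
Proof.
pose b := 1 + modulus w; have b0 : 0 < b by rewrite ltr_wpDr ?modulus_ge0.
have sb (v : C R) : Num.sqrt (1 + modulus v ^+ 2) <= 1 + modulus v.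
  have m0 := modulus_ge0 v; have m1 : 0 <= 1 + modulus v by rewrite addr_ge0.
  rewrite -[leRHS]ger0_norm // -sqrtr_sqr ler_wsqrtr //; lra.
have bb0 : 0 < (1 + b) * b by rewrite mulr_gt0 // addr_gt0.
have s0 (v : C R) : 0 < Num.sqrt (1 + modulus v ^+ 2) :> R.
  by rewrite sqrtr_gt0 ltr_wpDr ?exprn_ge0 ?modulus_ge0.
exists (2 / ((1 + b) * b)); first by rewrite divr_gt0.
move=> z zw; rewrite /= ler_pdivlMr ?mulr_gt0 // mulrAC ler_pdivrMr //.
have AB : Num.sqrt (1 + modulus z ^+ 2) * Num.sqrt (1 + modulus w ^+ 2) <=
    modulus (z - w) * (1 + b) * b.
  apply: ler_pM; rewrite ?sqrtr_ge0 ?sb // (le_trans (sb z))//.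
  have := modulusD (z - w) w; rewrite subrK => zle.
  have t1 : 0 <= (modulus (z - w) - 1) * b by rewrite mulr_ge0 ?ltW // subr_gt0.
  by move: t1; rewrite /b; lra.
by move: AB; set A := Num.sqrt _; set B := Num.sqrt _; lra.
Qed.

End SphereAndSubsequences.

(** * Normality from small diameters, and propagation of the limit in a Fatou component *)

Section FatouComponents.
Variable R : realType.
Implicit Types (x y z w : C R) (r e : R) (f : C R -> C R) (W : set (C R)).

Lemma inv_small e : 0 < e -> exists N, forall k, (N <= k)%N -> (k.+1%:R : R)^-1 <= e.
Proof.
move=> e0; have [N _ NP] := near_infty_natSinv_lt (PosNum e0).
by exists N => k Nk; apply/ltW; exact: NP.
Qed.

(** Three cases: some iterate recurs and gives a constant subsequence; the images of [w0] have a
    finite cluster point, which is then a constant limit; or they tend to infinity and take all of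
    [W] along. *)
Lemma normal_of_small_diameter f W w0 :
  (forall e, 0 < e -> exists N, forall n, (N <= n)%N -> forall z, W z ->
     modulus (iter n f z - iter n f w0) <= e) ->
  normal_on W (iterates f).
Proof.
move=> diam u uf.
have um i : exists n, forall z, u i z = Some (iter n f z).
  by have [n _ <-] := uf i; exists n.
have [m uE] := choice um.
have near_phi phi g : increasing_seq phi -> (forall e, 0 < e -> exists N, forall k z,
    (N <= k)%N -> W z -> chordal (u (phi k) z) (g z) < e) ->
    exists phi g, increasing_seq phi /\ cvg_unif_on_compacts W (u \o phi) g.
  move=> phiI phig; exists phi, g; split=> // K _ KW e /phig[N NP].
  by exists N => // k /= Nk z /KW Wz; exact: NP.
have [[B Bm]|/forallNP nB] :=
    pselect (exists B, forall N, exists i, (N <= i)%N /\ (m i <= B)%N).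
  have [b bP] := bounded_recurrent_value Bm.
  have [phi [phiI phib]] := extract_subsequence (fun _ => bP).
  apply: (near_phi phi (fun z => Some (iter b f z)) phiI) => e e0.
  exists 0%N => k z _ _; rewrite uE phib /= subrr modulus0 mulr0 mul0r //.
have minf B : exists N, forall i, (N <= i)%N -> (B <= m i)%N.
  have /existsNP[N NP] := nB B; exists N => i Ni; rewrite leqNgt; apply/negP => iB.
  by apply: NP; exists i; split=> //; exact: ltnW.
pose c i := iter (m i) f w0.
have diam' e : 0 < e -> exists N, forall i z, (N <= i)%N -> W z ->
    modulus (iter (m i) f z - c i) <= e.
  move=> /diam[N NP]; have [K KP] := minf N.
  by exists K => i z Ki Wz; apply: NP => //; exact: KP.
have [[B Bc]|/forallNP nBc] :=
    pselect (exists B, forall N, exists i, (N <= i)%N /\ modulus (c i) <= B).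
  have [|l lP] := @bounded_cluster R c B (fun=> True).
    by move=> N; have [i [Ni iB]] := Bc N; exists i.
  have [|phi [phiI phil]] := @extract_subsequence
      (fun k i => modulus (c i - l) <= k.+1%:R^-1).
    move=> k N; have k0 : 0 < (k.+1%:R : R)^-1 by rewrite invr_gt0.
    by have [i [Ni _ il]] := lP _ k0 N; exists i.
  apply: (near_phi phi (fun=> Some l) phiI) => e e0.
  have e8 : 0 < e / 8 by rewrite divr_gt0.
  have [N1 N1P] := diam' _ e8; have [N2 N2P] := inv_small e8.
  exists (maxn N1 N2) => k z; rewrite geq_max => /andP[k1 k2] Wz.
  rewrite uE (le_lt_trans (chordal_le _ _))//.
  have := modulus_tri (c (phi k)) (iter (m (phi k)) f z) l.
  have := N1P (phi k) z (leq_trans k1 (increasing_seq_ge k phiI)) Wz.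
  have := le_trans (phil k) (N2P k k2); lra.
apply: (near_phi id (fun=> None) _); first by [].
move=> e e0; have /existsNP[N NP] := nBc (4 / e + 1).
have [K KP] := diam' 1 ltr01.
exists (maxn N K) => i z; rewrite geq_max => /andP[Ni Ki] Wz; rewrite uE.
have e40 : 0 < 4 / e by rewrite divr_gt0.
rewrite (le_lt_trans (@chordal_infty _ _ (4 / e) _ _))//.
  have := KP i z Ki Wz; rewrite modulusB => ci.
  have [ciB|ciB] := leP (modulus (c i)) (4 / e + 1).
    by case: NP; exists i.
  have := modulus_subl (c i) (iter (m i) f z); lra.
have -> : 2 / (4 / e) = e / 2 by field; rewrite lt0r_neq0.
lra.
Qed.

Section Return.
Variables (f : C R -> C R) (p : R) (N : nat -> nat).
Hypothesis fl : pol_lim f.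
Hypothesis N_gt0 : forall k, (0 < N k)%N.

(** Uniformity on a disc is built in, so openness is immediate and the real content is closedness
    relative to the Fatou set. *)
Definition returning : set (C R) := [set x | exists2 r, 0 < r &
  forall e, 0 < e -> exists K, forall k, (K <= k)%N -> forall z, modulus (z - x) <= r ->
    modulus (iter (N k) f z - p%:C%C) <= e].

Lemma returning_open : open returning.
Proof.
apply/open_modulusP => x [r r0 rP]; exists (r / 2); first by rewrite divr_gt0.
move=> w wx; exists (r / 2); first by rewrite divr_gt0.
move=> e /rP[K KP]; exists K => k Kk z zw; apply: KP => //.
by rewrite (le_trans (modulus_tri w _ _))// [leRHS]splitr lerD // ltW.
Qed.

Lemma returning_cvg x : returning x -> forall e, 0 < e -> exists K, forall k,
  (K <= k)%N -> modulus (iter (N k) f x - p%:C%C) <= e.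
Proof.
move=> [r r0 rP] e /rP[K KP]; exists K => k Kk; apply: KP => //.
by rewrite subrr modulus0 ltW.
Qed.

Lemma closure_modulus (A : set (C R)) x e : closure A x -> 0 < e ->
  exists2 s, A s & modulus (s - x) < e.
Proof.
move=> Ax e0; have [|s [As sx]] := Ax [set w | modulus (w - x) < e].
  by apply/nbhs_modulusP; exists e.
by exists s.
Qed.

(* Normality forces every limit of f^N_k at x to agree with the limit p at
   nearby points of the returning set. *)
Lemma Fatou_returning_bounded x : Fatou f x -> closure returning x ->
  exists2 r, 0 < r & exists K, forall k, (K <= k)%N -> forall z, modulus (z - x) <= r ->
    modulus (iter (N k) f z - p%:C%C) <= 1.
Proof.
move=> [U [/open_modulusP oU Ux nU]] clx; apply: contrapT => /forall2NP nb.
have [c c0 cP] := chordal_separated (p%:C%C : C R).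
(* If boundedness failed, points tending to x would have images at distance more than 1 from p along
   a subsequence. *)
have [|ka [kaI kaP]] := @extract_subsequence (fun i k => exists z : C R,
    modulus (z - x) <= (i.+1%:R)^-1 /\ 1 < modulus (iter (N k) f z - p%:C%C)).
  move=> i K; have [] := nb (i.+1%:R^-1); first by rewrite invr_gt0 ltr0n.
  move=> /forallNP/(_ K)/existsNP[k /not_implyP[Kk /existsNP[z /not_implyP[zx zp]]]].
  by exists k; split=> //; exists z; split=> //; rewrite ltNge; apply/negP.
have [zz zzP] := choice kaP.
pose u i z : sphere R := Some (iter (N (ka i)) f z).
have [|phi [g [phiI gP]]] := nU u; first by move=> i; exists (N (ka i)); rewrite //= N_gt0.
have [rho rho0 rhoU] := oU x Ux.
pose r := rho / 4; have r0 : 0 < r by rewrite divr_gt0.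
have KU : box x r `<=` U.
  by move=> w /box_sub_disc wr; apply: rhoU; move: wr; rewrite /r; lra.
(* The chain of six comparisons below, through z and a nearby returning point s, has total length 30
   e, less than c. *)
pose e := c / 60; have e0 : 0 < e by rewrite divr_gt0.
have [i0 _ i0P] := gP _ (@compact_box R x r) KU e e0.
have [d d0 dP] := pol_lim_continuous x (pol_lim_iter (N (ka (phi i0))) fl) e0.
have dr0 : 0 < Num.min d r by rewrite lt_min d0.
have [s sS sx] := closure_modulus clx dr0.
have [K KP] := returning_cvg sS e0.
have [L LP] := inv_small dr0.
pose i := maxn i0 (maxn K L).
have i0i : (i0 <= i)%N := leq_maxl _ _.
have Ki : (K <= i)%N by rewrite /i leq_max leq_maxl orbT.
have Li : (L <= i)%N by rewrite /i leq_max leq_maxr orbT.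
have iphi := leq_trans _ (increasing_seq_ge i phiI).
have [zx zp] := zzP (phi i); set z := zz (phi i) in zx zp.
have zd : modulus (z - x) <= Num.min d r by rewrite (le_trans zx)// LP // iphi.
have small w : modulus (w - x) <= Num.min d r -> box x r w /\ modulus (w - x) <= d.
  by rewrite le_min => /andP[wd wr]; split=> //; exact: disc_sub_box.
have [zb zd'] := small z zd; have [sb sd] := small s (ltW sx).
have st (a b : sphere R) (t : R) : chordal a b <= t -> stereo_dist a b <= 3 * t.
  by move=> ab; rewrite (le_trans (stereo_le_chordal _ _))// ler_pM2l.
have a1 : stereo_dist (u (phi i) z) (g z) <= 3 * e := st _ _ _ (ltW (i0P i i0i z zb)).
have a2 : stereo_dist (u (phi i0) z) (g z) <= 3 * e := st _ _ _ (ltW (i0P i0 (leqnn _) z zb)).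
have a3 : stereo_dist (u (phi i0) s) (g s) <= 3 * e := st _ _ _ (ltW (i0P i0 (leqnn _) s sb)).
have a4 : stereo_dist (u (phi i) s) (g s) <= 3 * e := st _ _ _ (ltW (i0P i i0i s sb)).
have b1 : stereo_dist (u (phi i) s) (Some p%:C%C) <= 3 * (2 * e).
  apply: st; rewrite (le_trans (chordal_le _ _))// ler_pM2l // KP //.
  by rewrite (leq_trans _ (increasing_seq_ge _ kaI))// iphi.
have b2 : stereo_dist (u (phi i0) z) (u (phi i0) s) <= 3 * (2 * (2 * e)).
  apply: st; rewrite (le_trans (chordal_le _ _))// ler_pM2l //.
  rewrite (le_trans (modulus_tri (iter (N (ka (phi i0))) f x) _ _))//.
  by have := dP z zd'; have := dP s sd; rewrite (modulusB _ (iter _ _ s)); lra.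
have : c <= stereo_dist (u (phi i) z) (Some p%:C%C).
  by rewrite (le_trans (cP _ zp))// chordal_le_stereo.
have := stereo_dist_tri (g z) (u (phi i) z) (Some p%:C%C).
have := stereo_dist_tri (u (phi i0) z) (g z) (Some p%:C%C).
have := stereo_dist_tri (u (phi i0) s) (u (phi i0) z) (Some p%:C%C).
have := stereo_dist_tri (g s) (u (phi i0) s) (Some p%:C%C).
have := stereo_dist_tri (u (phi i) s) (g s) (Some p%:C%C).
rewrite (stereo_dist_sym (g z) (u (phi i0) z)) (stereo_dist_sym (g s) (u (phi i) s)).
have ce : c = 60 * e by rewrite /e; field.
by move: a1 a2 a3 a4 b1 b2 e0; rewrite ce; lra.
Qed.

(** Identity principle: around a returning point s within r/8 of x the iterates are within 1 of p on
    the disc of radius r/2 and converge to p on a small one. [two_constants] gives convergence on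
    radius r/4, which covers the r/8-disc around x. *)
Lemma Fatou_returning_closed x : Fatou f x -> closure returning x -> returning x.
Proof.
move=> Fx clx; have [r r0 [K KP]] := Fatou_returning_bounded Fx clx.
have r8 : 0 < r / 8 by rewrite divr_gt0.
have [s [t t0 tP] sx] := closure_modulus clx r8.
exists (r / 8) => // e e0.
have r2 : 0 < r / 2 by rewrite divr_gt0.
have [eta eta0 etaP] := two_constants ltr01 r2 t0 e0.
have [L LP] := tP _ eta0.
have zs_x z : modulus (z - s) <= r / 2 -> modulus (z - x) <= r.
  by move=> zs; rewrite (le_trans (modulus_tri s _ _))//; lra.
exists (maxn K L) => k; rewrite geq_max => /andP[Kk Lk] z zx.
have hl : pol_lim (fun w => iter (N k) f w - p%:C%C).
  exact: pol_limB (pol_lim_iter _ fl) (pol_lim_cst p).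
apply: (etaP _ s hl) => [w ws|w ws|].
- by apply: KP => //; exact: zs_x.
- by apply: LP.
- rewrite (le_trans (modulus_tri x _ _))// (modulusB x); lra.
Qed.

Lemma component_returning x : connected_component (Fatou f) x `&` returning !=set0 ->
  connected_component (Fatou f) x `<=` returning.
Proof.
move=> ne; set O := connected_component _ _ in ne *.
suff <- : O `&` returning = O by move=> y [].
apply: (@component_connected _ (Fatou f) x) => //.
  by exists returning => //; exact: returning_open.
exists (closure returning); first exact: closed_closure.
apply/seteqP; split=> y [Oy ry]; split=> //; first exact: subset_closure.
by apply: Fatou_returning_closed ry; exact: connected_component_sub Oy.
Qed.

Hypothesis N_ge : forall k, (k <= N k)%N.
Hypothesis p_escapes : forall d, (0 < d)%N -> iter d f p%:C%C <> p%:C%C.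

Lemma returning_wandering (O : set (C R)) : O `<=` returning ->
  forall n m : nat, n <> m -> (iter n f @` O) `&` (iter m f @` O) = set0.
Proof.
move=> Or; suff lt_case n m : (n < m)%N -> (iter n f @` O) `&` (iter m f @` O) = set0.
  move=> n m /eqP; rewrite neq_ltn => /orP[/lt_case //|/lt_case].
  by rewrite setIC.
move=> nm; apply/seteqP; split=> // _ [[a Oa <-] [b Ob ab]].
have d0 : (0 < m - n)%N by rewrite subn_gt0.
apply: (p_escapes d0); apply/eqP; rewrite -subr_eq0 -modulus_eq0 -normr_le0.
rewrite ger0_norm ?modulus_ge0 //; apply/ler_addgt0Pr => e e0; rewrite add0r.
have e2 : 0 < e / 2 by rewrite divr_gt0.
have [d d_gt0 dP] := pol_lim_continuous p%:C%C (pol_lim_iter (m - n) fl) e2.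
have [K1 K1P] := returning_cvg (Or _ Oa) e2.
have [K2 K2P] := returning_cvg (Or _ Ob) d_gt0.
pose k := maxn n (maxn K1 K2).
have nk : (n <= N k)%N by rewrite (leq_trans _ (N_ge k)) ?leq_maxl.
have k1 := K1P k _; have k2 := dP _ (K2P k _).
(* f^(m-n)(f^N_k(b)) = f^(N_k-n)(f^m(b)) = f^(N_k-n)(f^n(a)) = f^N_k(a): this point is close both to
   f^(m-n)(p) and to p. *)
rewrite -iterD (_ : (m - n + N k = (N k - n) + m)%N) in k2; last by lia.
rewrite iterD ab -iterD subnK // in k2.
rewrite (le_trans (modulus_tri (iter (N k) f a) _ _))// [e]splitr.
rewrite (modulusB (iter (m - n) f _)) lerD //.
  by apply: k2; rewrite /k !leq_max leqnn !orbT.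
by apply: k1; rewrite /k !leq_max leqnn !orbT.
Qed.

End Return.
End FatouComponents.

(** * Connectedness and area *)

Section PlaneTopology.
Variable R : realType.
Implicit Types (a b x y z w : C R) (r s t e : R) (A : set (C R)).

Lemma segment_component A a b :
  (forall t, 0 <= t <= 1 -> A (a + t%:C%C * (b - a))) -> connected_component A a b.
Proof.
move=> Aab; pose gam t : C R := a + t%:C%C * (b - a).
have gam_cont : continuous gam.
  move=> t B /nbhs_modulusP[r r0 rB].
  have M0 : 0 < modulus (b - a) + 1 by rewrite ltr_wpDl ?modulus_ge0.
  apply/nbhs_ballP; exists (r / (modulus (b - a) + 1)); first by rewrite /= divr_gt0.
  move=> s; rewrite /ball /= ltr_pdivlMr // => ts; apply: rB.
  rewrite /gam opprD addrACA subrr add0r -mulrBl -rmorphB modulusM modulus_real distrC.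
  by rewrite (le_lt_trans _ ts)// ler_wpM2l // lerDl.
exists (gam @` `[0, 1]%classic); last first.
  by exists 1; rewrite /= ?in_itv /= ?lexx ?ler01 // /gam mul1r subrKC.
split.
- by exists 0; rewrite /= ?in_itv /= ?lexx ?ler01 // /gam mul0r addr0.
- by move=> _ [t + <-]; rewrite /= in_itv /=; exact: Aab.
- apply: connected_continuous_connected; first exact: segment_connected.
  by apply: continuous_subspaceT; exact: gam_cont.
Qed.

Lemma open_component A x : open A -> open (connected_component A x).
Proof.
move=> /open_modulusP oA; apply/open_modulusP => y Ay.
have [r r0 rA] := oA y (connected_component_sub Ay).
exists r => // w wy; apply: connected_component_trans Ay _.
apply: segment_component => t /andP[t0 t1]; apply: rA.
rewrite addrAC subrr add0r modulusM modulus_real ger0_norm //.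
by rewrite (le_lt_trans _ wy)// ler_piMl // modulus_ge0.
Qed.

Lemma Fatou_open (f : C R -> C R) : open (Fatou f).
Proof.
apply/open_modulusP => z [U [oU Uz nU]].
have /open_modulusP/(_ z Uz)[r r0 rU] := oU.
by exists r => // w wz; exists U; split=> //; exact: rU.
Qed.

Lemma rat_near r e : 0 < e -> exists q : rat, `|ratr q - r| < e.
Proof.
move=> e0; have re : r - e < r + e by lra.
have [q] := rat_in_itvoo re; rewrite in_itv /= => /andP[q1 q2].
by exists q; rewrite ltr_distl q1.
Qed.

Definition rat_box (i : nat * rat * rat) : set (R * R) :=
  let I (q : rat) := `]ratr q - i.1.1.+1%:R^-1, ratr q + i.1.1.+1%:R^-1[%classic in
  I i.1.2 `*` I i.2.

Lemma rat_boxP i (u : R * R) : rat_box i u <->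
  `|ratr i.1.2 - u.1| < i.1.1.+1%:R^-1 /\ `|ratr i.2 - u.2| < i.1.1.+1%:R^-1.
Proof.
case: i u => [[n q] q'] [c d]; rewrite /rat_box /= !in_itv /= -!ltr_distl.
by rewrite (distrC c) (distrC d).
Qed.

(** Countably many boxes suffice, those with rational centre and half-width 1/(n+1) that lie in the
    set. Two points of such a box differ by less than 2/(n+1) in each coordinate, hence the choice
    1/(n+1) < r/4. *)
Lemma open_measurable_pair A : open A ->
  measurable [set u : R * R | A (u.1 +i* u.2)%C].
Proof.
move=> /open_modulusP oA; set B := [set u | _].
have -> : B = \bigcup_(i : nat * rat * rat) (if pselect (rat_box i `<=` B) then rat_box i else set0).
  apply/seteqP; split=> [[c d] /= Acd|u [i _]]; last first.
    by case: pselect => //= iB; exact: iB.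
  have [r r0 rA] := oA _ Acd.
  have [n _ /(_ n (leqnn n)) nr] := near_infty_natSinv_lt (PosNum (divr_gt0 r0 (ltr0n R 4))).
  rewrite /= in nr; have n0 : 0 < (n.+1%:R : R)^-1 by rewrite invr_gt0.
  have [q qc] := rat_near c n0; have [q' qd] := rat_near d n0.
  exists (n, q, q') => //; case: pselect => /=; first by move=> _; apply/rat_boxP.
  case=> -[x1 y1] /rat_boxP /= [x1q y1q]; apply: rA.
  rewrite (le_lt_trans (modulus_Re_Im _))// ReB ImB /=.
  move: (n.+1%:R^-1) nr x1q y1q qc qd => nn nr; clear -nr.
  rewrite !ltr_norml => /andP[? ?] /andP[? ?] /andP[? ?] /andP[? ?].
  have : `|x1 - c| < 2 * nn by rewrite ltr_norml; apply/andP; split; lra.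
  have : `|y1 - d| < 2 * nn by rewrite ltr_norml; apply/andP; split; lra.
  lra.
apply: countable_bigcupT_measurable; first exact: countableP.
move=> i; case: pselect => /= _; last exact: measurable0.
by apply: measurableX; exact: measurable_itv.
Qed.

End PlaneTopology.

(** * Topology and area of the tract *)

Section Tract.
Variable R : realType.
Variable h : R -> R.
Hypothesis h_gt0 : forall x, 0 < h x.
Hypothesis h_noninc : {homo h : x y / x <= y >-> y <= x}.
Hypothesis h_cont : continuous h.
Implicit Types (x y : R) (z w : C R).

Lemma notin_tract z : (~ tract h z) <->
  (complex.Re z < 0 \/ h (complex.Re z) < `|complex.Im z|).
Proof.
split=> [nT|[z0 [z1 _]|hz [_ z1]]]; [|lra|lra].
have [z0|z0] := ltP (complex.Re z) 0; first by left.
by right; rewrite ltNge; apply/negP => hz; apply: nT.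
Qed.

Lemma open_off_tract : open (~` tract h).
Proof.
apply/open_modulusP => z /notin_tract[z0|hz].
  exists (- complex.Re z); first by lra.
  move=> w wz; apply/notin_tract; left.
  have := le_lt_trans (Re_diff w z) wz; rewrite ltr_norml; lra.
pose gap := (`|complex.Im z| - h (complex.Re z)) / 2.
have gap0 : 0 < gap by rewrite divr_gt0 // subr_gt0.
have /cvgrPdist_lt/(_ gap gap0)/nbhs_ballP[d /= d0 dP] := h_cont (x := complex.Re z).
exists (Num.min d gap); first by rewrite lt_min d0.
move=> w; rewrite lt_min => /andP[wd wg]; apply/notin_tract; right.
have hw : `|h (complex.Re z) - h (complex.Re w)| < gap.
  by apply: dP; rewrite /ball /= distrC (le_lt_trans (Re_diff _ _)).
have iw : `|complex.Im w - complex.Im z| < gap.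
  by rewrite -ImB (le_lt_trans (Im_modulus _)).
have := ler_distD 0 (complex.Im z) (complex.Im z).
have := ler_normB (complex.Im w) (complex.Im w - complex.Im z).
rewrite opprB addrC subrK => i2.
move: hw; rewrite ltr_norml => /andP[h1 h2]; move: h1 h2 iw i2; rewrite /gap; lra.
Qed.

(** A polygonal path: inside the left half-plane to [corner], horizontally to [top] at a height
    exceeding h 0, then vertically to z. The sign [s] selects the side of the tract on which z
    lies. *)
Lemma tract_complement_connected z :
  ~ tract h z -> connected_component (~` tract h) (-1) z.
Proof.
have left_ok w : complex.Re w < 0 -> connected_component (~` tract h) (-1) w.
  move=> w0; apply: segment_component => t /andP[t0 t1] /=; apply/notin_tract; left.
  case: w w0 => a b /= a0; rewrite !mul0r subr0.
  have : t * a <= 0 by rewrite mulr_ge0_le0 // ltW.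
  have [->|tn0] := eqVneq t 0; first by rewrite !mul0r; lra.
  have : t * a < 0 by rewrite pmulr_rlt0 // lt_neqAle eq_sym tn0.
  lra.
move=> /notin_tract[/left_ok //|]; case: z => a b /= hb.
have [a0|a0] := ltP a 0; first exact: left_ok.
pose s : R := if 0 <= b then 1 else -1.
have s2 : s * s = 1 by rewrite /s; case: ifP; rewrite ?mulrNN mulr1.
have sb : s * b = `|b|.
  rewrite /s; case: ifPn; first by rewrite mul1r => /ger0_norm.
  by rewrite mulN1r -ltNge => /ltr0_norm.
have sn : `|s| = 1 by rewrite /s; case: ifP; rewrite ?normrN normr1.
pose Y := `|b| + h 0.
have hY x : 0 <= x -> h x < Y.
  move=> x0; have := h_noninc x0; have := h_gt0 a; rewrite /Y; lra.
pose top : C R := (a +i* (s * Y))%C; pose corner : C R := ((-1) +i* (s * Y))%C.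
have corner_ok := left_ok corner (ltrN10 R).
apply: connected_component_trans corner_ok _.
apply: (@connected_component_trans _ _ top).
  apply: segment_component => t /andP[t0 t1] /=; apply/notin_tract => /=.
  rewrite subrr !(mulr0, mul0r) addr0 subr0 addr0 normrM sn mul1r.
  have [|x0] := ltP; first by left.
  by right; rewrite (lt_le_trans (hY _ x0)) // ler_norm.
apply: connected_component_sym.
apply: segment_component => t /andP[t0 t1] /=; apply/notin_tract => /=; right.
rewrite subrr !(mulr0, mul0r) addr0 subr0 addr0.
have bs : b = s * `|b| by rewrite -sb mulrA s2 mul1r.
have -> : b + t * (s * Y - b) = s * (`|b| + t * (Y - `|b|)) by rewrite {1 2}bs; ring.
rewrite normrM sn mul1r ger0_norm.
  have : 0 <= t * (Y - `|b|) by rewrite mulr_ge0 // /Y; have := h_gt0 0; lra.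
  lra.
rewrite addr_ge0 // mulr_ge0 // /Y; have := h_gt0 0; lra.
Qed.

(** By monotonicity of h the boxes [n, n+1] x [-h n, h n] cover the tract. Openness of [A] gives the
    measurability needed for subadditivity. *)
Lemma tract_area (e : R) : (forall n : nat, 2 * h n%:R <= e / (2 ^ n.+1)%:R) ->
  forall A : set (C R), open A -> ~` tract h `<=` A -> (Area (~` A) <= e%:E)%E.
Proof.
move=> he A oA WA.
have e0 : 0 <= e.
  have := he 0%N; have := h_gt0 0%:R; rewrite expn1; lra.
pose B (n : nat) : set (R * R) :=
  `[n%:R, n.+1%:R]%classic `*` `[- h n%:R, h n%:R]%classic.
have mB n : measurable (B n) by apply: measurableX; exact: measurable_itv.
have mA : measurable [set u : R * R | (~` A) (u.1 +i* u.2)%C].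
  by have := measurableC (open_measurable_pair oA).
rewrite /Area.
apply: (@le_trans _ _ (\sum_(n <oo) (lebesgue_measure \x lebesgue_measure) (B n))%E).
  apply: measure_sigma_subadditive => // -[x y] /= nA.
  have [x0 hy] : tract h (x +i* y)%C.
    by apply: contrapT => nT; apply: nA; exact: WA.
  rewrite /= in x0 hy; exists (Num.truncn x) => //.
  have /andP[x1 x2] := truncn_itv x0.
  split; rewrite /= in_itv /=; first by rewrite x1 ltW.
  by rewrite -ler_norml (le_trans hy)// h_noninc.
rewrite (le_trans _ (epsilon_trick0 xpredT e0))//.
apply: lee_nneseries => n _; first by [].
rewrite product_measure1E; try exact: measurable_itv.
have l1 : lebesgue_measure (`[n%:R, n.+1%:R]%classic : set R) = 1%:E.
  rewrite lebesgue_measure_itv /= lte_fin ltr_nat ltnSn -EFinB.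
  by rewrite -natr1 addrAC subrr add0r.
have l2 : lebesgue_measure (`[- h n%:R, h n%:R]%classic : set R) = (2 * h n%:R)%:E.
  rewrite lebesgue_measure_itv /= lte_fin gtrN // -EFinB opprK.
  by congr (_%:E); ring.
have -> : (e / (2 ^ n.+1)%:R)%:E = (1%:E * (e / (2 ^ n.+1)%:R)%:E)%E by rewrite mul1e.
apply: lee_pmul => //; first by rewrite -l1; exact: lexx.
apply: (@le_trans _ _ (2 * h n%:R)%:E); last by rewrite lee_fin.
by rewrite -l2; exact: lexx.
Qed.

End Tract.

(** * The timetable of the images of W *)

Section Itinerary.
Variable R : realType.
Variables (f : C R -> C R) (W : set (C R)) (v r y t : nat -> R) (p : R).
Hypothesis W_exit : forall z, W z -> modulus (f z - (y 0%N)%:C%C) <= r 0%N.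
Hypothesis v_cvg : forall k, `|v k - p| <= 2 / k.+1%:R.
Hypothesis t_small : forall k, 0 < t k <= k.+1%:R^-1.
Hypothesis f_exit : forall k z, modulus (z - (y k)%:C%C) <= r k ->
  modulus (f z - (v k)%:C%C) <= t k.
Hypothesis f_diam : forall k z j, modulus (z - (v k)%:C%C) <= t k -> (j <= k.+1)%N ->
  modulus (iter j f z - iter j f (v k)%:C%C) <= k.+1%:R^-1.
Hypothesis f_return : forall k z, modulus (z - (v k)%:C%C) <= t k ->
  modulus (iter k.+1 f z - (y k.+1)%:C%C) <= r k.+1.

(** One step takes W to the exit disc at y_0. From the exit disc at y_k, one step leads to v_k and k
    + 1 further steps to the disc at y_(k+1). *)
Fixpoint exit_time k : nat := if k is k'.+1 then exit_time k' + k'.+2 else 1.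

Definition return_time k := (exit_time k).+1.

Lemma return_time_ge k : (k <= return_time k)%N.
Proof. by elim: k => // k; rewrite /return_time /=; lia. Qed.

Lemma exit_disc k z : W z -> modulus (iter (exit_time k) f z - (y k)%:C%C) <= r k.
Proof.
move=> Wz; elim: k => [|k IH]; first exact: W_exit.
rewrite /= addnC -addn1 -addnA iterD; apply: f_return.
by rewrite add1n iterS; exact: f_exit.
Qed.

Lemma return_disc k z : W z -> modulus (iter (return_time k) f z - (v k)%:C%C) <= t k.
Proof. by move=> Wz; apply/f_exit/exit_disc. Qed.

(** Consecutive return times differ by k + 2, so the offset j runs through 0, ..., k + 1, exactly
    the range covered by [f_diam]. *)
Lemma time_decomposition K n : (exit_time K < n)%N ->
  exists k j, [/\ (K <= k)%N, (j <= k.+1)%N & n = (j + return_time k)%N].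
Proof.
elim: n => // n IH; rewrite ltnS leq_eqVlt => /orP[/eqP <-|/IH[k [j [Kk jk ->]]]].
  by exists K, 0%N.
move: jk; rewrite leq_eqVlt => /orP[/eqP ->|jk].
  by exists k.+1, 0%N; split=> //; [exact: leqW|rewrite /return_time /=; lia].
by exists k, j.+1.
Qed.

Lemma iterates_small_diameter w0 : W w0 -> forall e, 0 < e ->
  exists N, forall n, (N <= n)%N -> forall z, W z ->
    modulus (iter n f z - iter n f w0) <= e.
Proof.
move=> Ww e e0; have e2 : 0 < e / 2 by rewrite divr_gt0.
have [K KP] := inv_small e2; exists (return_time K) => n /time_decomposition.
move=> [k [j [Kk jk ->]]] z Wz; rewrite !iterD.
have diam x : W x -> modulus (iter j f (iter (return_time k) f x) - iter j f (v k)%:C%C) <= e / 2.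
  by move=> Wx; rewrite (le_trans (f_diam (return_disc k Wx) jk))// KP.
rewrite (le_trans (modulus_tri (iter j f (v k)%:C%C) _ _))// [leRHS]splitr.
by rewrite lerD ?diam // modulusB diam.
Qed.

Lemma returning_of_open w : open W -> W w -> returning f p return_time w.
Proof.
move=> /open_modulusP oW /oW[s s0 sW]; exists (s / 2); first by rewrite divr_gt0.
move=> e e0; have e3 : 0 < e / 3 by rewrite divr_gt0.
have [K KP] := inv_small e3; exists K => k Kk z zw.
have Wz : W z by apply: sW; lra.
rewrite (le_trans (modulus_tri (v k)%:C%C _ _))//.
have := le_trans (return_disc k Wz) (proj2 (andP (t_small k))).
have := v_cvg k; rewrite -rmorphB modulus_real.
by have := KP k Kk; move: (k.+1%:R^-1) => q; lra.
Qed.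

End Itinerary.

Theorem theorem7 (R : realType) (delta : R) (delta_gt0 : 0 < delta) :
  exists f : C R -> C R, entire f /\
  exists Omega : set (C R),
    wandering_domain f Omega /\ (Area (~` Omega) < delta%:E)%E.
Proof.
(* As e >= 2, the n-th box has area at most (delta/2)/2^(n+1); the sum delta/2 leaves room for the
   strict inequality. *)
pose h x : R := delta / 8 * expR (- x).
have d8 : 0 < delta / 8 by rewrite divr_gt0.
have h_gt0 x : 0 < h x by rewrite mulr_gt0 // expR_gt0.
have h_noninc : {homo h : x y / x <= y >-> y <= x}.
  by move=> x y xy; rewrite ler_pM2l // ler_expR lerN2.
have h_cont : continuous h.
  move=> x; apply: cvgM; first exact: cvg_cst.
  by apply: continuous_comp; [exact: opp_continuous|exact: continuous_expR].
have h_small (n : nat) : 2 * h n%:R <= (delta / 2) / (2 ^ n.+1)%:R.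
  have e2 : 2 <= expR 1 :> R by have := expR_ge1Dx (1 : R).
  have en : (2 ^ n)%:R <= expR n%:R :> R.
    by rewrite -[n%:R]mulr1 expRM_natl natrX lerXn2r ?nnegrE ?expR_ge0.
  have p2 : 0 < (2 ^ n)%:R :> R by rewrite ltr0n expn_gt0.
  have : expR (- n%:R) <= ((2 ^ n)%:R)^-1 :> R.
    by rewrite expRN lef_pV2 ?posrE ?expR_gt0.
  rewrite expnS natrM invfM /h => /(ler_wpM2l (ltW d8)); lra.
have [f [v [r [y [p [fl fW [v_cvg p3 p_esc] [t [t_small f_exit f_diam f_ret]]]]]]]] :=
  wandering_map h_gt0 h_noninc.
have W0 : (~` tract h) (-1) by move=> [/=]; rewrite ler0N1.
have Wo := open_off_tract h_cont.
have WF : ~` tract h `<=` Fatou f.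
  move=> z Wz; exists (~` tract h); split=> //.
  apply: normal_of_small_diameter.
  exact: (iterates_small_diameter fW f_exit f_diam f_ret W0).
pose Omega := connected_component (Fatou f) (-1).
have WO : ~` tract h `<=` Omega.
  move=> z /(tract_complement_connected h_gt0 h_noninc)[B [B1 BW Bc] Bz].
  by exists B => //; split=> //; exact: subset_trans WF.
exists f; split; first exact: pol_lim_entire.
exists Omega; split; last first.
  apply: (@le_lt_trans _ _ (delta / 2)%:E); last by rewrite lte_fin; lra.
  by apply: (tract_area h_gt0 h_noninc h_small _ WO); apply/open_component/Fatou_open.
split; first by exists (-1) => //; exact: WF.
have rt k : (0 < return_time k)%N by [].
have p_not_periodic d : (0 < d)%N -> iter d f p%:C%C <> p%:C%C.
  (* Periodicity would give p >= d + 5, contradicting p <= 3. *)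
  case: d => // d _ dE; have := p_esc d; rewrite /orbit dE /=.
  have : 0 <= d%:R :> R by []. lra.
apply: (@returning_wandering _ f p return_time fl return_time_ge p_not_periodic).
apply: (component_returning fl rt); exists (-1); split.
  by apply: connected_component_refl; exact: WF.
exact: (returning_of_open fW v_cvg t_small f_exit f_ret Wo W0).
Qed.
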